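(* Let $K\subset O(n)$ be a compact subgroup acting irreducibly on $\mathbb{R}^n$ and let $f,g$ be two nonnegative $K$-invariant measurable functions on $\mathbb{R}^n$. Furthermore, assume that $f$ and $g$ are locally bounded and that $$\int_{\mathbb{R}^n} f(y)\,dy=+\infty .$$ Then there exists a convex $K$-invariant function $\phi:\mathbb{R}^n\to\mathbb{R}$ which is a weak solution on $\mathbb{R}^n$ of the Monge-Ampère equation $$f(\nabla\phi)\det D_{ij}\phi=g(x).$$
   Context: $K$-invariance of a function $h$ on $\mathbb{R}^n$ means $h(k\cdot x)=h(x)$ for all $k\in K$, $x\in\mathbb{R}^n$. ''Acting irreducibly'' means that the only $K$-invariant linear subspaces of $\mathbb{R}^n$ are $\{0\}$ and $\mathbb{R}^n$. For a convex function $\phi:\mathbb{R}^n\to\mathbb{R}$, $\nabla\phi$ denotes the multi-valued gradient (subdifferential): $(\nabla\phi)(x)$ is the set of slopes of all supporting hyperplanes to the graph of $\phi$ at $(x,\phi(x))$, i.e. the set of $p\in\mathbb{R}^n$ with $\phi(z)\ge\phi(x)+\langle p,z-x\rangle$ for all $z$. For $B\subset\mathbb{R}^n$, $\nabla\phi(B)=\bigcup_{x\in B}(\nabla\phi)(x)$. A convex function $\phi$ is a weak solution of $f(\nabla\phi)\det D_{ij}\phi=g(x)$ on $\mathbb{R}^n$ if $$\int_B g(x)\,dx=\int_{\nabla\phi(B)}f(y)\,dy$$ for every Borel set $B\subset\mathbb{R}^n$.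
   Formalization: The formal theorem excludes the trivial group K = {1} acting on R^1; by the literal definition this action is irreducible, and the claim then fails, e.g. for f the indicator of (0,∞) and g = 1. *)

(* Defs.v *)
From HB Require Import structures.
From mathcomp Require Import all_boot all_order all_algebra.
From mathcomp Require Import all_classical all_reals all_analysis.
From mathcomp Require Import measurable_realfun.

Set Implicit Arguments.
Unset Strict Implicit.
Unset Printing Implicit Defensive.

Import Order.TTheory GRing.Theory Num.Theory.
Import numFieldNormedType.Exports.

Local Open Scope classical_set_scope.
Local Open Scope ring_scope.

Section borel_matrix.
Context {R : realType} {m n : nat}.

HB.instance Definition _ :=
  @isMeasurable.Build (sigma_display (@open 'M[R]_(m, n))) 'M[R]_(m, n)
    <<s @open 'M[R]_(m, n) >>
    (@sigma_algebra0 _ setT _) (@sigma_algebraC _ _)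
    (@sigma_algebra_bigcup _ setT _).

End borel_matrix.

Section measurable_coordinates.
Context {R : realType} {m n : nat}.

Lemma open_bigcup_ratbox (U : set 'M[R]_(m, n)) : open U ->
  U = \bigcup_(c in [set c : {ffun 'I_m * 'I_n -> rat} * nat |
         forall M : 'M[R]_(m, n),
           (forall i j, ball (ratr (c.1 (i, j)) : R) c.2.+1%:R^-1 (M i j)) ->
           U M])
      [set M | forall i j, ball (ratr (c.1 (i, j)) : R) c.2.+1%:R^-1 (M i j)].
Proof.
move=> oU; apply/seteqP; split=> [M UM|M [c /= cU] /cU//].
have /nbhs_ballP[e /= e0 eU] : nbhs M U by exact: open_nbhs_nbhs.
have [k ke] : exists k, k.+1%:R^-1 < e / 2.
  have e20 : 0 < e / 2 by rewrite divr_gt0.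
  have [k _ /(_ k (leqnn k)) /=] := near_infty_natSinv_lt (PosNum e20).
  by exists k.
have ratP (ij : 'I_m * 'I_n) :
    exists q : rat, ball (ratr q : R) k.+1%:R^-1 (M ij.1 ij.2).
  have k0 : 0 < k.+1%:R^-1 :> R by [].
  have [|r [Mr [q _ qr]]] := @dense_rat R (ball (M ij.1 ij.2) k.+1%:R^-1) _
    (ball_open _ _).
    by exists (M ij.1 ij.2); exact: ballxx.
  by exists q; apply: ball_sym; rewrite qr.
have [q qP] := choice ratP.
exists ([ffun ij => q ij], k) => /= [N NP|i j]; last first.
  by rewrite ffunE; exact: (qP (i, j)).
apply: eU; split=> // i j.
have := NP i j; rewrite ffunE => qN.
rewrite [e]splitr; apply: (@ball_triangle _ _ (ratr (q (i, j)) : R)).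
  by apply/ball_sym/(le_ball (ltW ke)); exact: (qP (i, j)).
exact: (le_ball (ltW ke)).
Qed.

Lemma measurable_fun_coord (i : 'I_m) (j : 'I_n) :
  measurable_fun [set: 'M[R]_(m, n)] (fun M : 'M[R]_(m, n) => M i j).
Proof.
apply: (measurability _ (RGenOpens.measurableE R)) => _ [_ [a [b ->] <-]].
rewrite setTI; apply: sub_sigma_algebra.
by apply: open_comp; [move=> M _; exact: coord_continuous|exact: interval_open].
Qed.

Lemma measurable_fun_matrix d (T : measurableType d) (f : T -> 'M[R]_(m, n)) :
  (forall i j, measurable_fun [set: T] (fun t => f t i j)) ->
  measurable_fun [set: T] f.
Proof.
move=> mf; apply: (@measurability _ _ _ _ _ f (@open 'M[R]_(m, n))) => // _ [U oU <-]; rewrite setTI.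
rewrite (open_bigcup_ratbox oU) preimage_bigcup bigcup_mkcond.
apply: countable_bigcupT_measurable => // c.
case: ifPn => // _.
rewrite [X in measurable X](_ : _ = \bigcap_(ij in [set: 'I_m * 'I_n])
  [set t | ball (ratr (c.1 ij) : R) c.2.+1%:R^-1 (f t ij.1 ij.2)]); last first.
  by apply/seteqP; split=> t /= => [+ [i j] _|+ i j]; [exact|move/(_ (i, j)); exact].
apply: fin_bigcap_measurable => // -[i j] _.
by rewrite -[X in measurable X]setTI; apply: mf => //; exact: measurable_ball.
Qed.

End measurable_coordinates.

Section lebesgue_measure_cV.
Context {R : realType}.

Definition cons_cV n (p : R * 'cV[R]_n) : 'cV[R]_n.+1 :=
  col_mx (const_mx p.1 : 'cV_1) p.2.

Definition uncons_cV n (v : 'cV[R]_n.+1) : R * 'cV[R]_n :=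
  (v 0 0, dsubmx (v : 'cV_(1 + n))).

Lemma cons_cV0 n (p : R * 'cV[R]_n) j : cons_cV p ord0 j = p.1.
Proof.
rewrite /cons_cV (_ : ord0 = lshift n ord0 :> 'I_(1 + n)); last exact/val_inj.
by rewrite (@col_mxEu _ 1) mxE.
Qed.

Lemma cons_cVS n (p : R * 'cV[R]_n) i j : cons_cV p (lift ord0 i) j = p.2 i j.
Proof.
rewrite /cons_cV (_ : lift ord0 i = rshift 1 i :> 'I_(1 + n)).
  by rewrite (@col_mxEd _ 1).
exact/val_inj.
Qed.

Lemma cons_cVK n : cancel (@cons_cV n) (@uncons_cV n).
Proof.
move=> [x v]; rewrite /uncons_cV; congr pair; first exact: cons_cV0.
exact: col_mxKd.
Qed.

Lemma measurable_cons_cV n : measurable_fun [set: R * 'cV[R]_n] (@cons_cV n).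
Proof.
apply: measurable_fun_matrix => i j; have [k ->|->] := unliftP ord0 i.
  rewrite (_ : (fun p => _) = (fun v : 'cV_n => v k j) \o snd).
    exact: measurableT_comp (measurable_fun_coord k j) measurable_snd.
  by apply/funext => p; exact: cons_cVS.
rewrite (_ : (fun p => _) = fst); first exact: measurable_fst.
by apply/funext => p; exact: cons_cV0.
Qed.

Lemma measurable_uncons_cV n :
  measurable_fun [set: 'cV[R]_n.+1] (@uncons_cV n).
Proof.
apply: measurable_fun_pair; first exact: measurable_fun_coord.
apply: measurable_fun_matrix => i j.
under eq_fun do rewrite mxE.
exact: measurable_fun_coord.
Qed.

Section cons_measure.
Context n (mu : {sigma_finite_measure set 'cV[R]_n -> \bar R}).

Definition cons_measure : set 'cV[R]_n.+1 -> \bar R :=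
  pushforward (lebesgue_measure \x mu)%E (@cons_cV n).

Let cons_measure0 : cons_measure set0 = 0%E.
Proof. by rewrite /cons_measure /pushforward preimage_set0 measure0. Qed.

Let cons_measure_ge0 A : (0 <= cons_measure A)%E.
Proof. by rewrite /cons_measure /pushforward measure_ge0. Qed.

Let cons_measure_sigma_additive : semi_sigma_additive cons_measure.
Proof.
by have mcons := @measurable_cons_cV n; exact: measure_semi_sigma_additive.
Qed.

HB.instance Definition _ := isMeasure.Build _ _ _ cons_measure
  cons_measure0 cons_measure_ge0 cons_measure_sigma_additive.

Let cons_measure_sigma_finite : sigma_finite [set: 'cV[R]_n.+1] cons_measure.
Proof.
have /sigma_finiteP[F [TF ndF Foo]] := sigma_finiteT (@lebesgue_measure R).
have /sigma_finiteP[G [TG ndG Goo]] := sigma_finiteT mu.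
exists (fun k => @uncons_cV n @^-1` (F k `*` G k)) => [|k].
  apply/seteqP; split=> // v _.
  have : [set: R] (v 0 0) by [].
  rewrite TF => -[i _ Fi].
  have : [set: 'cV[R]_n] (uncons_cV v).2 by [].
  rewrite TG => -[j _ Gj].
  exists (maxn i j) => //; split.
  - by move: Fi; exact/subsetPset/ndF/leq_maxl.
  - by move: Gj; exact/subsetPset/ndG/leq_maxr.
have [mF Fk] := Foo k; have [mG Gk] := Goo k.
have mFG : measurable (F k `*` G k) by exact: measurableX.
split.
  by rewrite -[X in measurable X]setTI; exact: measurable_uncons_cV.
rewrite /cons_measure /pushforward -comp_preimage.
rewrite (_ : _ \o _ = id); last by apply/funext => p; exact: cons_cVK.
by rewrite preimage_id product_measure1E// lte_mul_pinfty// ge0_fin_numE.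
Qed.

HB.instance Definition _ := Measure_isSigmaFinite.Build _ _ _ cons_measure
  cons_measure_sigma_finite.

End cons_measure.

(* The product measure on the Borel sets of R^n, by recursion through the
   identification R^(n+1) = R * R^n. *)
Fixpoint borel_lebesgue_cV n : {sigma_finite_measure set 'cV[R]_n -> \bar R} :=
  match n with
  | 0 => \d_ (0 : 'cV[R]_0)
  | k.+1 => cons_measure (borel_lebesgue_cV k)
  end.

Lemma borel_lebesgue_cV_box n (A : 'I_n -> set R) :
  (forall i, measurable (A i)) ->
  borel_lebesgue_cV n [set v | forall i, A i (v i 0)] =
    (\prod_(i < n) lebesgue_measure (A i))%E.
Proof.
elim: n A => [|n IHn] A mA /=.
  by rewrite big_ord0 diracE mem_set// => -[].
rewrite big_ord_recl -IHn; last by move=> i; exact: mA.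
have mbox : measurable
    [set v : 'cV[R]_n | forall i, A (lift ord0 i) (v i 0)].
  rewrite [X in measurable X](_ : _ = \bigcap_(i in [set: 'I_n])
    [set v : 'cV[R]_n | A (lift ord0 i) (v i 0)]); last first.
    by apply/seteqP; split=> v /= Av i => [_|]; exact: Av.
  apply: fin_bigcap_measurable => // i _.
  by rewrite -[X in measurable X]setTI; exact: measurable_fun_coord.
rewrite -(product_measure1E lebesgue_measure (borel_lebesgue_cV n) (mA ord0) mbox).
rewrite /cons_measure /pushforward.
congr (_ _); apply/seteqP; split=> -[x v] /=.
- move=> Axv; split=> [|i] /=; first by have := Axv ord0; rewrite cons_cV0.
  by have := Axv (lift ord0 i); rewrite cons_cVS.
- move=> [/= Ax Av] i; have [j ->|->] := unliftP ord0 i.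
    by rewrite cons_cVS; exact: Av.
  by rewrite cons_cV0.
Qed.

(* The sigma-algebra of Lebesgue measurable subsets of R^n is the one carried
   by the type [lebesgue_type n], a copy of 'cV[R]_n; it is strictly larger
   than the Borel one carried by 'cV[R]_n. *)
Definition lebesgue_type n := caratheodory_type ((borel_lebesgue_cV n)^*)%mu.

HB.instance Definition _ n := Measurable.on (lebesgue_type n).

Definition lebesgue_cV n : set (lebesgue_type n) -> \bar R :=
  @completed_measure_extension _ _ _ (borel_lebesgue_cV n).

HB.instance Definition _ n := Measure.on (@lebesgue_cV n).

End lebesgue_measure_cV.
Arguments lebesgue_type R n : clear implicits.
Arguments lebesgue_cV R n : clear implicits.

Section group_action.
Context {R : realType} {n : nat}.
Implicit Types (K : set 'M[R]_n).

Definition orthogonal_group : set 'M[R]_n := [set k | k^T *m k = 1%:M].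

Definition matrix_subgroup K :=
  [/\ K 1%:M, (forall k l, K k -> K l -> K (k *m l)) &
      (forall k, K k -> K (invmx k))].

Definition acts_irreducibly K := forall V : {vspace 'cV[R]_n},
  (forall k v, K k -> v \in V -> k *m v \in V) -> V = 0%VS \/ V = fullv.

Definition invariant_fun K (h : 'cV[R]_n -> R) :=
  forall k x, K k -> h (k *m x) = h x.

End group_action.

Section monge_ampere.
Context {R : realType} {n : nat}.
Implicit Types (x p : 'cV[R]_n) (f g phi : 'cV[R]_n -> R).

Definition locally_bounded f := forall x, bounded_near f (nbhs x).

Definition dotcV x p : R := \sum_(i < n) x i 0 * p i 0.

Definition subdifferential phi x : set 'cV[R]_n :=
  [set p | forall z, phi x + dotcV p (z - x) <= phi z].

Definition gradient_image phi (B : set 'cV[R]_n) : set 'cV[R]_n :=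
  \bigcup_(x in B) subdifferential phi x.

(* [B] ranges over the Borel sets, while the integrals are taken on the
   Lebesgue sigma-algebra: [gradient_image phi B] is Lebesgue measurable but
   need not be Borel. *)
Definition monge_ampere_weak_solution f g phi :=
  forall B : set 'cV[R]_n, measurable B ->
    (\int[lebesgue_cV R n]_(x in B) (g x)%:E =
     \int[lebesgue_cV R n]_(y in gradient_image phi B) (f y)%:E)%E.

End monge_ampere.

(* Main.v *)
Require Import Defs.
From HB Require Import structures.
From mathcomp Require Import all_boot all_order all_algebra.
From mathcomp Require Import all_classical all_reals all_analysis.
From mathcomp Require Import measurable_realfun.
From mathcomp Require Import ring lra.

(** Solve first a transport problem between finite measures living on Euclidean balls, then let the source ball grow.

On the balls of radii a and b, the cost (integral of phi against the source measure) + (integral of the Legendre transform phi^c against the target measure) is minimized over the b-Lipschitz functions. The cost is submodular, since the transform of a minimum is the maximum of the transforms, so the normalized minimizers have a greatest element, and the uniqueness of that element makes it K-invariant. Comparing a minimizer phi with phi + t 1_U for an open set U bounds the target mass of the slopes attained only on U by the source mass of U. Slopes attained at two points form a Lebesgue null set, because by monotonicity the relevant closed pieces meet each line parallel to some axis at most once.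

To have equal masses, the source is g on the ball of radius r plus a constant density on the annulus between r and r + 1, and the target is f on a ball large enough to carry more mass than g puts on the ball of radius r. Irreducibility gives c > 0 with sup_k <k p, z> >= c |p| |z|; if p is a slope of an invariant convex phi at a point of the ball of radius rho, then the slopes attained on the ball of radius 2 rho / c fill the ball of radius c |p| / 2. Its f-mass is at most the g-mass of a fixed ball, and f has infinite mass, so the slopes are bounded on each ball independently of r. A subsequence then converges locally uniformly, and slopes pass to the limit: limsup over closed sets, liminf (off the null set) over open sets. *)

Set Implicit Arguments.
Unset Strict Implicit.
Unset Printing Implicit Defensive.

Import Order.TTheory GRing.Theory Num.Theory.
Import numFieldNormedType.Exports.

Local Open Scope classical_set_scope.
Local Open Scope ring_scope.

(** * Lebesgue measure and orthogonal maps *)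

(** No regularity theory and no transport map enter. The variational problem yields a single
    inequality, for the mass of slopes attained only on an open set. Because the total masses agree,
    applying it to the complement of a closed set gives the reverse inequality, and this pair of
    inequalities is stable under locally uniform limits. Equality is recovered only at the very end,
    from the bounded open sets, which generate the Borel sets. The filler mass sits on an annulus so
    that inside the ball of radius [r] the source is exactly [g]; being constant there, it keeps the
    source invariant. Minimizers need not be unique, since [f] and [g] may vanish on large sets,
    which is why a greatest one is singled out. Two sigma-algebras coexist because the image of a
    complement is controlled only up to the null set of slopes attained twice, and only a complete
    measure absorbs an arbitrary part of that set. *)

Section lebesgue_invariance.
Context {R : realType}.

Lemma norm_cV_leP n (v : 'cV[R]_n) (e : R) :
  0 <= e -> `|v| <= e <-> forall i, `|v i 0| <= e.
Proof.
move=> e0; rewrite -[e]/((NngNum e0)%:num) -[`|v|]/(mx_norm v) mx_normE num_le.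
split=> [/bigmax_leP[_ ve] i|ve]; first by have := ve (i, 0) erefl; rewrite -num_le.
by apply/bigmax_leP; split=> // -[i j] _; rewrite -num_le /= (ord1 j).
Qed.

Lemma norm_coord_le n (v : 'cV[R]_n) i : `|v i 0| <= `|v|.
Proof. by have [+ _] := norm_cV_leP v (normr_ge0 v); exact. Qed.

Definition open_box n (a b : 'I_n -> R) : set 'cV[R]_n :=
  [set v | forall i, a i < v i 0 < b i].

Definition open_boxes n : set (set 'cV[R]_n) :=
  [set B | exists a b : 'I_n -> R, B = open_box a b].

Lemma open_boxesI n : setI_closed (@open_boxes n).
Proof.
move=> _ _ [a [b ->]] [c [d ->]].
exists (fun i => Num.max (a i) (c i)), (fun i => Num.min (b i) (d i)).
apply/seteqP; split=> [v [/= vab vcd] i|v /= vabcd].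
  have /andP[av vb] := vab i; have /andP[cv vd] := vcd i.
  by rewrite gt_max lt_min av cv vb vd.
by split=> i; have := vabcd i; rewrite gt_max lt_min => /andP[/andP[? ?] /andP[? ?]]; apply/andP.
Qed.

Lemma open_box_measurable n (a b : 'I_n -> R) : measurable (open_box a b).
Proof.
rewrite [X in measurable X](_ : _ = \bigcap_(i in [set: 'I_n])
    ((fun v : 'cV[R]_n => v i 0) @^-1` `]a i, b i[)).
  apply: fin_bigcap_measurable => // i _.
  by rewrite -[X in measurable X]setTI; apply: measurable_fun_coord.
apply/seteqP; split=> [v /= vab i _ /=|v /= vab i]; first by rewrite in_itv /= vab.
by have := vab i I; rewrite /= in_itv.
Qed.

Lemma sigma_open_boxes n : @measurable _ 'cV[R]_n = <<s @open_boxes n >>.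
Proof.
apply/seteqP; split; last first.
  apply: smallest_sub; first exact: sigma_algebra_measurable.
  by move=> _ [a [b ->]]; exact: open_box_measurable.
apply: smallest_sub; first exact: smallest_sigma_algebra.
move=> U oU; rewrite (open_bigcup_ratbox oU) bigcup_mkcond.
have mC (A : ({ffun 'I_n * 'I_1 -> rat} * nat)%type -> set (g_sigma_algebraType (@open_boxes n))) :
    (forall c, measurable (A c)) -> measurable (\bigcup_c A c).
  by move=> mA; apply: countable_bigcupT_measurable.
apply: (mC) => c; case: ifPn => _; last exact: measurable0.
apply: sub_sigma_algebra.
exists (fun i => ratr (c.1 (i, 0)) - c.2.+1%:R^-1), (fun i => ratr (c.1 (i, 0)) + c.2.+1%:R^-1).
apply/seteqP; split=> [v /= vc i|v /= vc i j].
  by have := vc i 0; rewrite /ball /= ltr_distlC.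
by rewrite (ord1 j); have := vc i; rewrite /ball /= ltr_distlC.
Qed.

Lemma borel_lebesgue_cV_open_box n (a b : 'I_n -> R) :
  borel_lebesgue_cV n (open_box a b) =
    (\prod_(i < n) (if (a i < b i)%R then (b i - a i)%:E else 0))%E.
Proof.
have -> : open_box a b = [set v | forall i, `]a i, b i[%classic (v i 0)].
  by apply/seteqP; split=> v /= + i => /(_ i); rewrite in_itv.
rewrite (borel_lebesgue_cV_box (A := fun i => `]a i, b i[%classic))//.
apply: eq_bigr => i _.
by rewrite lebesgue_measure_itv/= lte_fin; case: ifPn => //.
Qed.

(** Open boxes form a generating pi-system, and the space is a countable union of boxes of finite
    measure. Push-forwards by translations and reflections therefore need to be compared on boxes
    only. *)
Lemma borel_lebesgue_cV_unique n (m : {measure set 'cV[R]_n -> \bar R}) :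
  (forall a b : 'I_n -> R, m (open_box a b) = borel_lebesgue_cV n (open_box a b)) ->
  forall A, measurable A -> m A = borel_lebesgue_cV n A.
Proof.
move=> mE A mA.
apply: (measure_unique (@open_boxes n) (fun k => open_box (fun=> - k%:R) (fun=> k%:R))) => //.
- exact: sigma_open_boxes.
- exact: open_boxesI.
- by move=> k; exists (fun=> - k%:R), (fun=> k%:R).
- apply/seteqP; split=> // v _.
  exists (Num.truncn `|v|).+1 => // i /=.
  rewrite -ltr_norml (le_lt_trans _ (truncnS_gt _))//.
  exact: norm_coord_le.
- by move=> _ [a [b ->]].
- move=> k; rewrite mE borel_lebesgue_cV_open_box.
  rewrite ltey_eq; apply/orP; left.
  elim/big_ind: _ => // [x y|i _]; first exact: fin_numM.
  by case: ifPn.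
Qed.


Lemma measurable_fun_linear n (k : 'M[R]_n) :
  measurable_fun [set: 'cV[R]_n] (fun v : 'cV[R]_n => k *m v).
Proof.
apply: measurable_fun_matrix => i j.
under eq_fun do rewrite mxE.
apply: measurable_sum => l; apply: measurable_funM => //.
exact: measurable_fun_coord.
Qed.

Lemma measurable_fun_translate n (t : 'cV[R]_n) :
  measurable_fun [set: 'cV[R]_n] (fun v : 'cV[R]_n => v + t).
Proof.
apply: measurable_fun_matrix => i j.
under eq_fun do rewrite mxE.
by apply: measurable_funD => //; exact: measurable_fun_coord.
Qed.

Lemma measurable_fun_reflect n (t : 'cV[R]_n) :
  measurable_fun [set: 'cV[R]_n] (fun v : 'cV[R]_n => t - v).
Proof.
apply: measurable_fun_matrix => i j.
under eq_fun do rewrite !mxE.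
by apply: measurable_funB => //; exact: measurable_fun_coord.
Qed.

Lemma borel_lebesgue_translate n (t : 'cV[R]_n) A : measurable A ->
  borel_lebesgue_cV n ((fun v => v + t) @^-1` A) = borel_lebesgue_cV n A.
Proof.
have mt := measurable_fun_translate t => mA.
apply: (@borel_lebesgue_cV_unique n (pushforward (borel_lebesgue_cV n) (fun v => v + t))) => // a b.
transitivity (borel_lebesgue_cV n ((fun v => v + t) @^-1` open_box a b)) => //.
have -> : (fun v => v + t) @^-1` (open_box a b) =
    open_box (fun i => a i - t i 0) (fun i => b i - t i 0).
  apply/seteqP; split=> v /= + i => /(_ i); rewrite ?mxE.
    by rewrite ltrBlDr ltrBrDr.
  by rewrite ltrBlDr ltrBrDr.
rewrite !borel_lebesgue_cV_open_box; apply: eq_bigr => i _.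
by rewrite ltrD2r opprB addrA subrK.
Qed.

Lemma borel_lebesgue_reflect n (t : 'cV[R]_n) A : measurable A ->
  borel_lebesgue_cV n ((fun v => t - v) @^-1` A) = borel_lebesgue_cV n A.
Proof.
have mt := measurable_fun_reflect t => mA.
apply: (@borel_lebesgue_cV_unique n (pushforward (borel_lebesgue_cV n) (fun v => t - v))) => // a b.
transitivity (borel_lebesgue_cV n ((fun v => t - v) @^-1` open_box a b)) => //.
have -> : (fun v => t - v) @^-1` (open_box a b) =
    open_box (fun i => t i 0 - b i) (fun i => t i 0 - a i).
  apply/seteqP; split=> v /= + i => /(_ i); rewrite ?mxE => /andP[? ?]; apply/andP; split; lra.
rewrite !borel_lebesgue_cV_open_box; apply: eq_bigr => i _.
rewrite ltrD2l ltrN2 (_ : t i 0 - a i - (t i 0 - b i) = b i - a i)//.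
ring.
Qed.

End lebesgue_invariance.

(** * Orthogonal invariance of the Borel measure by a Fubini argument *)

Section orthogonal_invariance.
Context {R : realType} {n : nat}.
Implicit Types (A B : set 'cV[R]_n) (k : 'M[R]_n).
Let lam := @borel_lebesgue_cV R n.

(* By Fubini, the measure of [shear k A B] is lam A * lam (k^-1 B), and by reflection invariance of the sections it is symmetric in A and B. *)
Let shear k A B : set ('cV[R]_n * 'cV[R]_n) := [set p | A p.1 /\ B (k *m p.2 - p.1)].

Let measurable_shear k A B : measurable A -> measurable B -> measurable (shear k A B).
Proof.
move=> mA mB.
rewrite [X in measurable X](_ : _ = (fst @^-1` A) `&`
  ((fun p : 'cV[R]_n * 'cV[R]_n => k *m p.2 - p.1) @^-1` B))//.
apply: measurableI.
  by rewrite -[X in measurable X]setTI; exact: measurable_fst.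
rewrite -[X in measurable X]setTI.
suff mf : measurable_fun setT (fun p : 'cV[R]_n * 'cV[R]_n => k *m p.2 - p.1) by exact: mf.
apply: measurable_fun_matrix => i j.
under eq_fun do rewrite !mxE.
apply: measurable_funB.
  apply: measurable_sum => l; apply: measurable_funM => //.
  exact: measurableT_comp (measurable_fun_coord l j) measurable_snd.
exact: measurableT_comp (measurable_fun_coord i j) measurable_fst.
Qed.

Let shear1 k A B : measurable A -> measurable B -> k \in unitmx ->
  (lam \x lam)%E (shear k A B) = (lam A * lam ((mulmx k) @^-1` B))%E.
Proof.
move=> mA mB ku.
have mkB : measurable (mulmx k @^-1` B).
  by rewrite -[X in measurable X]setTI; exact: measurable_fun_linear.
transitivity (\int[lam]_x lam (xsection (shear k A B) x))%E => //.
transitivity (\int[lam]_x ((\1_A x)%:E * lam (mulmx k @^-1` B)))%E.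
  apply: eq_integral => x _; rewrite indicE.
  have [xA|xA] := boolP (x \in A).
    rewrite mul1e -(@borel_lebesgue_translate _ _ (- (invmx k *m x)) _ mkB).
    congr (lam _); apply/seteqP; split => y; rewrite /xsection /shear /= inE /=.
      by move=> [_]; rewrite mulmxDr mulmxN mulmxA mulmxV// mul1mx.
    by rewrite mulmxDr mulmxN mulmxA mulmxV// mul1mx; split => //; exact: set_mem.
  rewrite mul0e (_ : xsection _ _ = set0) ?measure0//.
  apply/seteqP; split=> // y; rewrite /xsection /shear /= inE /= => -[Ax].
  by move/negP: xA; rewrite inE.
rewrite ge0_integralZr//; last exact: measurableT_comp.
by rewrite integral_indic// setIT.
Qed.

Let shear2 k A B : measurable A -> measurable B ->
  (lam \x lam)%E (shear k A B) = (\int[lam]_y lam (ysection (shear k A B) y))%E.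
Proof.
move=> mA mB.
rewrite (@product_measure_unique _ _ _ _ _ _ _ (lam \x^ lam)%E)//.
  by move=> C D mC mD; exact: product_measure2E.
exact: measurable_shear.
Qed.

Let shear_sym k A B : measurable A -> measurable B -> k \in unitmx ->
  (lam A * lam (mulmx k @^-1` B) = lam B * lam (mulmx k @^-1` A))%E.
Proof.
move=> mA mB ku; rewrite -shear1// -[RHS]shear1// !shear2//.
apply: eq_integral => y _.
have -> : ysection (shear k A B) y = (fun v => k *m y - v) @^-1` (ysection (shear k B A) y).
  apply/seteqP; split => x; rewrite /ysection /shear /= !inE /= subKr => -[? ?]; split => //.
apply: borel_lebesgue_reflect.
by apply: measurable_ysection; exact: measurable_shear.
Qed.

Lemma dotcV_sum (v : 'cV[R]_n) : dotcV v v = \sum_i v i 0 ^+ 2.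
Proof. by apply: eq_bigr => i _; rewrite expr2. Qed.

Lemma dotcV_mulmx k (u v : 'cV[R]_n) : orthogonal_group k ->
  dotcV (k *m u) (k *m v) = dotcV u v.
Proof.
have dE (x y : 'cV[R]_n) : dotcV x y = (x^T *m y) 0 0.
  by rewrite mxE; apply: eq_bigr => i _; rewrite mxE.
by move=> ko; rewrite !dE trmx_mul -mulmxA (mulmxA k^T) ko mul1mx.
Qed.

Lemma orthogonal_unitmx k : orthogonal_group k -> k \in unitmx.
Proof. by move=> ko; have [] := mulmx1_unit ko. Qed.

(** The symmetry of [shear] is applied to the closed unit ball, which [k] preserves; its measure is
    positive and finite, hence cancels. No determinant is involved. *)
Lemma borel_lebesgue_orthogonal k B : orthogonal_group k -> measurable B ->
  lam (mulmx k @^-1` B) = lam B.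
Proof.
move=> ko mB.
pose A := [set v : 'cV[R]_n | dotcV v v <= 1].
have mA : measurable A.
  have mf : measurable_fun setT (fun v : 'cV[R]_n => dotcV v v).
    by apply: measurable_sum => i; apply: measurable_funM; exact: measurable_fun_coord.
  rewrite [A](_ : _ = (fun v : 'cV[R]_n => dotcV v v) @^-1` `]-oo, 1]); last first.
    by apply/seteqP; split => v; rewrite /A /= in_itv.
  by rewrite -[X in measurable X]setTI; exact: mf.
have kA : mulmx k @^-1` A = A.
  by apply/seteqP; split => v; rewrite /A /= dotcV_mulmx.
(* A cube of half side [1/(n+1)] lies in the ball: each of the [n] squared coordinates is at most
   [1/(n+1)]. *)
have A_gt0 : (0 < lam A)%E.
  apply: (@lt_le_trans _ _ (lam (open_box (fun=> - n.+1%:R^-1) (fun=> n.+1%:R^-1)))).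
    rewrite borel_lebesgue_cV_open_box.
    elim/big_ind : _ => // [x y x0 y0|i _]; first exact: mule_gt0.
    have e0 : 0 < n.+1%:R^-1 :> R by [].
    by move: (n.+1%:R^-1) e0 => e e0; rewrite ifT ?lte_fin; lra.
  apply: le_measure; rewrite ?inE//; first exact: open_box_measurable.
  move=> v /= vA; rewrite /A /= dotcV_sum.
  apply: (@le_trans _ _ (\sum_(i < n) n.+1%:R^-1)).
    apply: ler_sum => i _; have := vA i; rewrite -ltr_norml => vi.
    rewrite -real_normK ?num_real// expr2 -[leRHS]mulr1 ler_pM// ?ltW//.
    by rewrite (lt_le_trans vi)// invf_le1// ler1n.
  rewrite sumr_const card_ord -[_ *+ n]mulr_natl ler_pdivrMr// mul1r ler_nat//.
have A_oo : (lam A < +oo)%E.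
  apply: (@le_lt_trans _ _ (lam (open_box (fun=> - 2) (fun=> 2)))).
    apply: le_measure; rewrite ?inE//; first exact: open_box_measurable.
    move=> v; rewrite /A /= dotcV_sum => v1 i.
    rewrite -ltr_norml ltNge; apply/negP => v2; move: v1; rewrite leNgt => /negP; apply.
    rewrite (bigD1 i)//= (@lt_le_trans _ _ (v i 0 ^+ 2))//.
      by rewrite -real_normK ?num_real// expr2; nra.
    by rewrite lerDl sumr_ge0// => j _; exact: sqr_ge0.
  rewrite borel_lebesgue_cV_open_box ltey_eq; apply/orP; left.
  elim/big_ind: _ => // [x y|i _]; first exact: fin_numM.
  by case: ifPn.
have := shear_sym mA mB (orthogonal_unitmx ko).
rewrite kA [RHS]muleC => AB.
have Afin : lam A \is a fin_num by rewrite ge0_fin_numE.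
by apply: le_anti; rewrite -(lee_pmul2l Afin A_gt0) -[X in _ && X](lee_pmul2l Afin A_gt0) AB muleC lexx.
Qed.

End orthogonal_invariance.

(** * The completed Lebesgue measure *)

Section lebesgue_cV_facts.
Context {R : realType} {n : nat}.
Implicit Types (A B E : set 'cV[R]_n) (k : 'M[R]_n).

Lemma borel_lebesgue_measurable A : measurable A ->
  @measurable _ (lebesgue_type R n) A.
Proof. exact: caratheodory_measurable_mu_ext. Qed.

Lemma lebesgue_cV_borel A : measurable A -> lebesgue_cV R n A = borel_lebesgue_cV n A.
Proof. by move=> mA; exact: measurable_mu_extE. Qed.

Lemma lebesgue_cV_open_box_lty (a b : 'I_n -> R) : (lebesgue_cV R n (open_box a b) < +oo)%E.
Proof.
rewrite lebesgue_cV_borel ?borel_lebesgue_cV_open_box; last exact: open_box_measurable.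
rewrite ltey_eq; apply/orP; left.
elim/big_ind: _ => // [x y|i _]; first exact: fin_numM.
by case: ifPn.
Qed.

Lemma lebesgue_cV_open_box_gt0 (a b : 'I_n -> R) : (forall i, a i < b i) ->
  (0 < lebesgue_cV R n (open_box a b))%E.
Proof.
move=> ab; rewrite lebesgue_cV_borel ?borel_lebesgue_cV_open_box; last exact: open_box_measurable.
elim/big_ind : _ => // [x y x0 y0|i _]; first exact: mule_gt0.
by rewrite ab lte_fin subr_gt0.
Qed.

Lemma le_lebesgue_cV A B : A `<=` B -> (lebesgue_cV R n A <= lebesgue_cV R n B)%E.
Proof. exact: le_mu_ext. Qed.

Lemma lebesgue_cV_bounded_lty A (M : R) : (forall v i, A v -> `|v i 0| < M) ->
  (lebesgue_cV R n A < +oo)%E.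
Proof.
move=> AM; apply: le_lt_trans (lebesgue_cV_open_box_lty (fun=> - M) (fun=> M)).
by apply: le_lebesgue_cV => v /AM vM i; rewrite -ltr_norml.
Qed.

Lemma lebesgue_cV_open_gt0 A v : open A -> A v -> (0 < lebesgue_cV R n A)%E.
Proof.
move=> oA Av.
have /nbhs_ballP[e /= e0 eA] : nbhs v A by exact: open_nbhs_nbhs.
apply: (@lt_le_trans _ _ (lebesgue_cV R n (open_box (fun i => v i 0 - e) (fun i => v i 0 + e)))).
  by apply: lebesgue_cV_open_box_gt0 => i; lra.
apply: le_lebesgue_cV => w vw; apply: eA; split=> // i j.
by rewrite (ord1 j) /ball /= ltr_distlC; exact: vw.
Qed.

Section null_lines.
Variables (E : set 'cV[R]_n) (e : 'cV[R]_n).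
Hypothesis (mE : measurable E).
Hypothesis (line1 : forall v t, E v -> E (v + t *: e) -> t = 0).

(* The translates of E by e / (j + 1) are pairwise disjoint, have the same measure and stay in a bounded box. *)
Lemma borel_lebesgue_null_lines_bounded (M : R) : (forall v i, E v -> `|v i 0| < M) -> borel_lebesgue_cV n E = 0%E.
Proof.
move=> EM; set lam := borel_lebesgue_cV n.
pose F (j : nat) := (fun v => v + (j.+1%:R^-1 *: e)) @^-1` E.
have mF j : measurable (F j).
  by rewrite -[X in measurable X]setTI; exact: measurable_fun_translate.
have lF j : lam (F j) = lam E by exact: borel_lebesgue_translate.
have tF : trivIset setT F.
  apply/trivIsetP => i j _ _ ij; apply/seteqP; split => // v [/= vi vj].
  have : v + i.+1%:R^-1 *: e + (j.+1%:R^-1 - i.+1%:R^-1) *: e = v + j.+1%:R^-1 *: e.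
    by rewrite -addrA -scalerDl subrKC.
  move=> eq; move: vj; rewrite /F /= -eq => /(line1 vi)/eqP; rewrite subr_eq0 => /eqP/invr_inj/eqP.
  by rewrite eqr_nat eqSS eq_sym => /eqP ji; rewrite ji eqxx in ij.
pose B := open_box (fun=> - (M + `|e|)) (fun=> M + `|e|) : set (matrix _ n 1).
have C_lty : (lam B < +oo)%E.
  rewrite -lebesgue_cV_borel; last exact: open_box_measurable.
  exact: lebesgue_cV_open_box_lty.
set C := lam _ in C_lty.
have NC N : ((N%:R)%:E * lam E <= C)%E.
  have -> : ((N%:R)%:E * lam E = lam (\big[setU/set0]_(j < N) F j))%E.
    rewrite measure_bigsetU// (eq_bigr (fun=> lam E)) => [|j _]; last exact: lF.
    elim: N => [|N IH]; first by rewrite big_ord0 mul0e.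
    by rewrite big_ord_recr/= -IH -natr1 EFinD ge0_muleDl// ?lee_fin// mul1e.
  apply: le_measure; rewrite ?inE; [exact: bigsetU_measurable|exact: open_box_measurable|].
  rewrite -bigcup_mkord => v [j _ vEj] i; have {}vEj j' := EM _ j' vEj; rewrite -ltr_norml.
  have := vEj i; rewrite !mxE => vj.
  have jei : `|j.+1%:R^-1 * e i 0| <= `|e|.
    rewrite normrM (le_trans _ (norm_coord_le e i))// ler_piMl//.
    by rewrite ger0_norm// invf_le1// ler1n.
  rewrite -(addrK (j.+1%:R^-1 * e i 0) (v i 0)).
  by rewrite (le_lt_trans (ler_normB _ _))// ltr_leD.
have E_fin : lam E \is a fin_num.
  by rewrite ge0_fin_numE// (le_lt_trans _ C_lty)//; have := NC 1%N; rewrite mul1e.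
have C_fin : C \is a fin_num by rewrite /C ge0_fin_numE.
apply: contrapT => /eqP E0.
have {}E0 : 0 < fine (lam E) by rewrite fine_gt0// lt0e E0 measure_ge0 ltey_eq E_fin.
have [N] : exists N : nat, fine C / fine (lam E) < N%:R.
  by exists (Num.truncn (fine C / fine (lam E))).+1; rewrite truncnS_gt.
rewrite ltr_pdivrMr// ltNge => /negP; apply.
by rewrite -lee_fin EFinM !fineK.
Qed.

End null_lines.

Lemma lebesgue_cV_null_lines E (e : 'cV[R]_n) : measurable E ->
  (forall v t, E v -> E (v + t *: e) -> t = 0) -> lebesgue_cV R n E = 0%E.
Proof.
move=> mE line1; rewrite lebesgue_cV_borel//.
pose D (m : nat) := open_box (fun=> - m%:R) (fun=> m%:R) : set 'cV[R]_n.
have DT : \bigcup_m D m = setT.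
  apply/seteqP; split=> // v _.
  exists (Num.truncn `|v|).+1 => // i /=.
  by rewrite -ltr_norml (le_lt_trans _ (truncnS_gt _))// norm_coord_le.
have mED m : measurable (E `&` D m) by apply: measurableI => //; exact: open_box_measurable.
rewrite -[E]setIT -DT setI_bigcupr; apply/negligibleP; first exact: bigcupT_measurable.
apply: negligible_bigcup => m; apply/negligibleP => //.
apply: (@borel_lebesgue_null_lines_bounded _ e _ _ m%:R) => // [v t [Ev _] [Et _]|v i [_ vD]]; first exact: line1 Et.
by rewrite ltr_norml; exact: vD.
Qed.

(** The completed measure is an outer measure on all sets: a Borel cover of [A] pulls back to a
    Borel cover of the preimage with the same masses. *)
Let lebesgue_cV_orthogonal_le k A : orthogonal_group k ->
  (lebesgue_cV R n (mulmx k @^-1` A) <= lebesgue_cV R n A)%E.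
Proof.
move=> ko; apply: le_ereal_inf_tmp => _ [F [mF AF] <-].
apply: ereal_inf_lbound; exists (fun j => mulmx k @^-1` (F j)).
  split=> [j|]; last by rewrite -preimage_bigcup; exact: preimage_subset.
  by rewrite -[X in measurable X]setTI; exact: measurable_fun_linear.
by apply: eq_eseriesr => j _; exact: borel_lebesgue_orthogonal.
Qed.

Lemma orthogonal_invmx k : orthogonal_group k -> invmx k = k^T.
Proof.
move=> ko; have ku := orthogonal_unitmx ko.
by rewrite -[RHS]mulmx1 -(mulmxV ku) mulmxA ko mul1mx.
Qed.

Lemma orthogonal_group_invmx k : orthogonal_group k -> orthogonal_group (invmx k).
Proof.
move=> ko; rewrite /orthogonal_group /= {1}orthogonal_invmx// trmxK.
by rewrite mulmxV// orthogonal_unitmx.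
Qed.

Lemma mulmx_invmxK k : orthogonal_group k -> cancel (mulmx k : 'cV[R]_n -> _) (mulmx (invmx k)).
Proof. by move=> ko v; rewrite mulmxA mulVmx ?mul1mx ?orthogonal_unitmx. Qed.

Lemma mulmxK_invmx k : orthogonal_group k -> cancel (mulmx (invmx k) : 'cV[R]_n -> _) (mulmx k).
Proof. by move=> ko v; rewrite mulmxA mulmxV ?mul1mx ?orthogonal_unitmx. Qed.

Lemma lebesgue_cV_orthogonal k A : orthogonal_group k ->
  lebesgue_cV R n (mulmx k @^-1` A) = lebesgue_cV R n A.
Proof.
move=> ko; apply: le_anti; rewrite lebesgue_cV_orthogonal_le//=.
rewrite -[X in (lebesgue_cV _ _ X <= _)%E](_ : mulmx (invmx k) @^-1` (mulmx k @^-1` A) = A).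
  by apply/lebesgue_cV_orthogonal_le/orthogonal_group_invmx.
by apply/seteqP; split=> v /=; rewrite (mulmxK_invmx ko).
Qed.

(** [mulmx k] preserves the outer measure of every set, so Caratheodory's splitting condition for
    [A] passes to its preimage once the test set [X] is pushed forward by [k]. *)
Lemma measurable_fun_orthogonal k : orthogonal_group k ->
  measurable_fun [set: lebesgue_type R n] (mulmx k : lebesgue_type R n -> lebesgue_type R n).
Proof.
move=> ko _ A mA; rewrite setTI.
have {}mA : caratheodory_measurable (lebesgue_cV R n) A := mA.
suff : caratheodory_measurable (lebesgue_cV R n) (mulmx k @^-1` A) by [].
move=> X; have ko' := orthogonal_group_invmx ko.
have E Y : lebesgue_cV R n Y = lebesgue_cV R n (mulmx (invmx k) @^-1` Y).
  by rewrite lebesgue_cV_orthogonal.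
rewrite (E X) (E (X `&` _)) (E (X `&` ~` _)) !preimage_setI -preimage_setC.
rewrite (_ : mulmx (invmx k) @^-1` (mulmx k @^-1` A) = A); first exact: mA.
by apply/seteqP; split=> v /=; rewrite (mulmxK_invmx ko).
Qed.

Lemma integral_orthogonal k (h : 'cV[R]_n -> R) (A : set (lebesgue_type R n)) :
  orthogonal_group k -> measurable_fun [set: lebesgue_type R n] h -> (forall x, 0 <= h x) ->
  (forall x, h (k *m x) = h x) -> measurable A ->
  (\int[lebesgue_cV R n]_(x in mulmx k @^-1` A) (h x)%:E =
   \int[lebesgue_cV R n]_(x in A) (h x)%:E)%E.
Proof.
move=> ko mh h0 hk mA.
have mk := measurable_fun_orthogonal ko.
transitivity (\int[pushforward (lebesgue_cV R n) (mulmx k : lebesgue_type R n -> lebesgue_type R n)]_(x in A) (h x)%:E)%E.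
  have mhA : measurable_fun A (fun x => (h x)%:E).
    by apply: measurable_funTS; exact/measurable_EFinP.
  have h0A : {in A, forall x, (0 <= (h x)%:E)%E} by move=> x _; rewrite lee_fin.
  rewrite (ge0_integral_pushforward mk _ mA mhA h0A).
  by apply: eq_integral => x _ /=; rewrite hk.
by apply: eq_measure_integral => B mB _; exact: lebesgue_cV_orthogonal.
Qed.

End lebesgue_cV_facts.

(** * Euclidean geometry and subdifferentials *)

Section euclidean.
Context {R : realType} {n : nat}.
Implicit Types (u v w x y z : 'cV[R]_n) (r : R).

Lemma dotcVC u v : dotcV u v = dotcV v u.
Proof. by apply: eq_bigr => i _; rewrite mulrC. Qed.

Lemma dotcVDl u v w : dotcV (u + v) w = dotcV u w + dotcV v w.
Proof. by rewrite /dotcV -big_split; apply: eq_bigr => i _; rewrite mxE mulrDl. Qed.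

Lemma dotcVZl r u v : dotcV (r *: u) v = r * dotcV u v.
Proof. by rewrite /dotcV mulr_sumr; apply: eq_bigr => i _; rewrite mxE mulrA. Qed.

Lemma dotcVNl u v : dotcV (- u) v = - dotcV u v.
Proof. by rewrite -scaleN1r dotcVZl mulN1r. Qed.

Lemma dotcVBl u v w : dotcV (u - v) w = dotcV u w - dotcV v w.
Proof. by rewrite dotcVDl dotcVNl. Qed.

Lemma dotcVDr u v w : dotcV w (u + v) = dotcV w u + dotcV w v.
Proof. by rewrite dotcVC dotcVDl !(dotcVC w). Qed.

Lemma dotcVZr r u v : dotcV u (r *: v) = r * dotcV u v.
Proof. by rewrite dotcVC dotcVZl dotcVC. Qed.

Lemma dotcVNr u v : dotcV u (- v) = - dotcV u v.
Proof. by rewrite dotcVC dotcVNl dotcVC. Qed.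

Lemma dotcVBr u v w : dotcV w (u - v) = dotcV w u - dotcV w v.
Proof. by rewrite dotcVDr dotcVNr. Qed.

Lemma dotcV0l u : dotcV 0 u = 0.
Proof. by rewrite -(scale0r 0) dotcVZl mul0r. Qed.

Lemma dotcV0r u : dotcV u 0 = 0.
Proof. by rewrite dotcVC dotcV0l. Qed.

Lemma dotcV_ge0 u : 0 <= dotcV u u.
Proof. by rewrite dotcV_sum sumr_ge0// => i _; exact: sqr_ge0. Qed.

Lemma dotcV_eq0 u : dotcV u u = 0 -> u = 0.
Proof.
rewrite dotcV_sum => /eqP; rewrite psumr_eq0 => [/allP u0|i _]; last exact: sqr_ge0.
apply/matrixP => i j; rewrite (ord1 j) mxE; apply/eqP.
by rewrite -sqrf_eq0; apply: u0; rewrite mem_index_enum.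
Qed.

(** The norm carried by ['cV[R]_n] is the maximum of the coordinates, which orthogonal maps do not
    preserve; hence a separate Euclidean norm. *)
Definition enorm u : R := Num.sqrt (dotcV u u).

Lemma enorm_ge0 u : 0 <= enorm u. Proof. exact: sqrtr_ge0. Qed.

Lemma enorm_sqr u : enorm u ^+ 2 = dotcV u u.
Proof. by rewrite sqr_sqrtr// dotcV_ge0. Qed.

Lemma enorm_leP u r : 0 <= r -> (enorm u <= r) = (dotcV u u <= r ^+ 2).
Proof. by move=> r0; rewrite -enorm_sqr ler_sqr// nnegrE// enorm_ge0. Qed.

Lemma enorm0 : enorm 0 = 0. Proof. by rewrite /enorm dotcV0l sqrtr0. Qed.

Lemma enorm_eq0 u : enorm u = 0 -> u = 0.
Proof. by move=> u0; apply: dotcV_eq0; rewrite -enorm_sqr u0 expr0n. Qed.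

Lemma enorm_gt0 u : u != 0 -> 0 < enorm u.
Proof.
move=> u0; rewrite lt_neqAle enorm_ge0 andbT; apply: contra u0.
by rewrite eq_sym => /eqP/enorm_eq0/eqP.
Qed.

Lemma enormZ r u : enorm (r *: u) = `|r| * enorm u.
Proof.
by rewrite /enorm dotcVZl dotcVZr mulrA -expr2 sqrtrM ?sqr_ge0// sqrtr_sqr.
Qed.

Lemma enormN u : enorm (- u) = enorm u.
Proof. by rewrite -scaleN1r enormZ normrN1 mul1r. Qed.

Lemma cauchy_schwarz u v : dotcV u v <= enorm u * enorm v.
Proof.
have [->|u0] := eqVneq u 0; first by rewrite dotcV0l enorm0 mul0r.
have [->|v0] := eqVneq v 0; first by rewrite dotcV0r enorm0 mulr0.
have := dotcV_ge0 (enorm v *: u - enorm u *: v).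
rewrite dotcVBl !dotcVBr !dotcVZl !dotcVZr (dotcVC v u) -!enorm_sqr.
have := enorm_gt0 u0; have := enorm_gt0 v0.
move: (enorm u) (enorm v) (dotcV u v) => a b c b0 a0 H.
have : 0 <= (a * b) * (a * b - c) by nra.
by rewrite pmulr_rge0 ?mulr_gt0// subr_ge0.
Qed.

Lemma enormD u v : enorm (u + v) <= enorm u + enorm v.
Proof.
rewrite enorm_leP ?addr_ge0 ?enorm_ge0// dotcVDl !dotcVDr (dotcVC v u) sqrrD !enorm_sqr.
have := cauchy_schwarz u v; lra.
Qed.

Lemma enormB u v : enorm (u - v) = enorm (v - u).
Proof. by rewrite -enormN opprB. Qed.

Lemma norm_coord_enorm u i : `|u i 0| <= enorm u.
Proof.
rewrite -sqrtr_sqr ler_wsqrtr// dotcV_sum (bigD1 i)//= lerDl sumr_ge0// => j _.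
exact: sqr_ge0.
Qed.

Lemma enorm_le_norm u : enorm u <= n%:R * `|u|.
Proof.
rewrite enorm_leP ?mulr_ge0// dotcV_sum.
apply: (@le_trans _ _ (\sum_(i < n) `|u| ^+ 2)).
  apply: ler_sum => i _; rewrite -(real_normK (num_real (u i 0))).
  by rewrite ler_sqr ?nnegrE// norm_coord_le.
rewrite sumr_const card_ord -[_ *+ n]mulr_natl exprMn ler_wpM2r ?sqr_ge0//.
by rewrite -natrX ler_nat; case: (n) => // m; rewrite expnS expn1 leq_pmulr.
Qed.

Lemma enorm_orthogonal k u : orthogonal_group k -> enorm (k *m u) = enorm u.
Proof. by move=> ko; rewrite /enorm dotcV_mulmx. Qed.

Lemma cvg_dotcV (T : Type) (F : set_system T) {FF : Filter F} (f g : T -> 'cV[R]_n) u v :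
  f @ F --> u -> g @ F --> v -> dotcV (f t) (g t) @[t --> F] --> dotcV u v.
Proof.
move=> fu gv; apply: cvg_big => [|i _]; first exact: add_continuous.
have cu := cvg_comp _ _ fu (@coord_continuous R n 1 i 0 u).
have cv := cvg_comp _ _ gv (@coord_continuous R n 1 i 0 v).
exact: (cvgM cu cv).
Qed.

Lemma continuous_dotcV (T : topologicalType) (f g : T -> 'cV[R]_n) :
  continuous f -> continuous g -> continuous (fun t => dotcV (f t) (g t)).
Proof. by move=> cf cg t; exact: cvg_dotcV (cf t) (cg t). Qed.

Lemma enorm_continuous : continuous enorm.
Proof.
move=> u; apply: (@continuous_comp _ _ _ (fun v => dotcV v v) Num.sqrt); last exact: sqrt_continuous.
by move: u; apply: continuous_dotcV => u; exact: cvg_id.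
Qed.

Definition cball r : set 'cV[R]_n := [set v | enorm v <= r].

Lemma closed_cball r : closed (cball r).
Proof.
by apply: (closed_comp (f := enorm) (D := [set t | t <= r])); [move=> v _; exact: enorm_continuous|exact: closed_le].
Qed.

Lemma compact_cball r : compact (cball r).
Proof.
pose B := [set v : 'rV[R]_n | enorm v^T <= r].
have tr_cont : continuous (fun v : 'rV[R]_n => v^T).
  move=> v A /nbhs_ballP[e /= e0 eA]; apply/nbhs_ballP; exists e => //= w [_ vw].
  by apply: eA; split=> // i j; rewrite !mxE.
have -> : cball r = trmx @` B.
  apply/seteqP; split => [v vr|_ [v vB <-]//].
  by exists v^T; rewrite /B /= ?trmxK.
apply: continuous_compact; first exact: continuous_subspaceT.
apply: bounded_closed_compact.
  exists r; split; rewrite ?num_real// => M rM v vB.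
  have M0 : 0 <= M by rewrite (le_trans _ (ltW rM))// (le_trans _ vB)// enorm_ge0.
  change (is_true (mx_norm v <= (NngNum M0)%:num)); rewrite mx_normE num_le.
  apply/bigmax_leP; split=> // -[i j] _; rewrite -num_le/= (ord1 i).
  have := norm_coord_enorm v^T j; rewrite mxE => /le_trans; apply.
  exact: le_trans vB (ltW rM).
apply: (closed_comp (f := fun v : 'rV[R]_n => enorm v^T) (D := [set t | t <= r])); last exact: closed_le.
by move=> v _; apply: continuous_comp; [exact: tr_cont|exact: enorm_continuous].
Qed.

Lemma nbhs_enorm u (A : set 'cV[R]_n) : nbhs u A <->
  exists2 e : R, 0 < e & forall v, enorm (v - u) < e -> A v.
Proof.
split=> [/nbhs_ballP[e /= e0 eA]|[e e0 eA]].
  exists e => // v vu; apply: eA; split=> // i j; rewrite (ord1 j) /ball /= distrC.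
  by rewrite (le_lt_trans _ vu)//; have := norm_coord_enorm (v - u) i; rewrite !mxE.
have : \forall v \near u, enorm (v - u) < e.
  have c : (fun v => enorm (v - u)) @ u --> enorm (u - u).
    apply: (@continuous_comp _ _ _ (fun v => v - u) enorm); last exact: enorm_continuous.
    exact: (cvgB cvg_id (cvg_cst _)).
  by apply: (cvgr_lt _ c); rewrite subrr enorm0.
by apply: filterS => v; exact: eA.
Qed.

End euclidean.

(** The tube lemma: if [Q] misses every [(x, y)] with [x] in [P], compactness of [P] gives one
    neighbourhood of [y] that works for all [x]. *)
Lemma closed_proj (X Y : topologicalType) (P : set X) (Q : set (X * Y)) :
  compact P -> closed Q -> closed [set y | exists2 x, P x & Q (x, y)].
Proof.
move=> /compact_near_coveringP cP cQ; rewrite -openC openE => y /= ny.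
have : \forall y' \near y, P `<=` (fun x => ~ Q (x, y')).
  apply: cP => x Px.
  have : open (~` Q) by exact: closed_openC.
  have nQ : ~ Q (x, y) by move=> Qxy; apply: ny; exists x.
  rewrite openE => /(_ (x, y) nQ); rewrite /interior /= => H.
  by apply: (filterS (F := filter_prod (nbhs x) (nbhs y)) _ H) => -[].
by apply: filterS => y' + [x Px Qxy] => /(_ x Px).
Qed.

(** * Subdifferentials, doubly attained slopes, measurability of images *)

Section subdifferentials.
Context {R : realType} {n : nat}.
Implicit Types (phi : 'cV[R]_n -> R) (x y z p : 'cV[R]_n) (A B C : set 'cV[R]_n).

Lemma closed_subdifferential_graph phi : continuous phi ->
  closed [set q : 'cV[R]_n * 'cV[R]_n | subdifferential phi q.1 q.2].
Proof.
move=> cphi.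
rewrite [X in closed X](_ : _ = \bigcap_z [set q : 'cV[R]_n * 'cV[R]_n |
    phi q.1 + dotcV q.2 (z - q.1) <= phi z]).
  apply: closed_bigI => z _.
  pose f (q : 'cV[R]_n * 'cV[R]_n) := phi q.1 + dotcV q.2 (z - q.1).
  apply: (closed_comp (f := f) (D := [set t | t <= phi z])); last exact: closed_le.
  move=> q _.
  have c1 : phi t.1 @[t --> q] --> phi q.1.
    by apply: (@continuous_comp _ _ _ fst phi); [exact: cvg_fst|exact: cphi].
  have c2 : (z - t.1) @[t --> q] --> z - q.1 by apply: cvgB; [exact: cvg_cst|exact: cvg_fst].
  have c3 : t.2 @[t --> q] --> q.2 by exact: cvg_snd.
  exact: (cvgD c1 (cvg_dotcV c3 c2)).
by apply/seteqP; split=> [q /= h z _|q /= h z]; [exact: h|exact: h].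
Qed.

Lemma gradient_image_closed phi C : continuous phi -> compact C ->
  closed (gradient_image phi C).
Proof.
move=> cphi cC.
have -> : gradient_image phi C = [set y | exists2 x, C x & subdifferential phi x y] by [].
exact: (closed_proj cC (closed_subdifferential_graph cphi)).
Qed.

Lemma subdifferential_monotone phi x y p q :
  subdifferential phi x p -> subdifferential phi y q -> 0 <= dotcV (p - q) (x - y).
Proof.
move=> /(_ y) + /(_ x); rewrite !dotcVBr !dotcVBl; lra.
Qed.

(** That two contact points differ is not a closed condition; separating them by a slab in
    coordinate [i], inside a compact ball, makes it closed. The case of interest is [a < b]. *)
Definition double_slope phi (i : 'I_n) (a b : R) (r : R) : set 'cV[R]_n :=
  [set p | exists2 xy : 'cV[R]_n * 'cV[R]_n, (cball r `*` cball r) xy &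
     [/\ subdifferential phi xy.1 p, subdifferential phi xy.2 p,
         xy.1 i 0 <= a & b <= xy.2 i 0]].

Lemma double_slope_closed phi i a b r : continuous phi -> closed (double_slope phi i a b r).
Proof.
move=> cphi.
pose Q := [set t : ('cV[R]_n * 'cV[R]_n) * 'cV[R]_n |
  [/\ subdifferential phi t.1.1 t.2, subdifferential phi t.1.2 t.2,
         t.1.1 i 0 <= a & b <= t.1.2 i 0]].
apply: (@closed_proj _ _ (cball r `*` cball r) Q).
  by apply: compact_setX; exact: compact_cball.
pose T : Type := (('cV[R]_n * 'cV[R]_n) * 'cV[R]_n)%type.
have -> : Q = [set t : T | subdifferential phi t.1.1 t.2] `&`
    [set t : T | subdifferential phi t.1.2 t.2] `&`
    [set t : T | t.1.1 i 0 <= a] `&` [set t : T | b <= t.1.2 i 0].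
  by apply/seteqP; split=> [t /= [? ? ? ?]|t /= [[[? ?] ?] ?]].
have c11 : continuous (fun t : ('cV[R]_n * 'cV[R]_n) * 'cV[R]_n => t.1.1).
  by move=> t; apply: (@continuous_comp _ _ _ fst fst); exact: cvg_fst.
have c12 : continuous (fun t : ('cV[R]_n * 'cV[R]_n) * 'cV[R]_n => t.1.2).
  by move=> t; apply: (@continuous_comp _ _ _ fst snd); [exact: cvg_fst|exact: cvg_snd].
have c2 : continuous (fun t : ('cV[R]_n * 'cV[R]_n) * 'cV[R]_n => t.2).
  by move=> t; exact: cvg_snd.
have pairc (f g : ('cV[R]_n * 'cV[R]_n) * 'cV[R]_n -> 'cV[R]_n) :
    continuous f -> continuous g -> continuous (fun t => (f t, g t)).
  by move=> cf cg t; exact: (cvg_pair (cf t) (cg t)).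
apply: closedI; [apply: closedI; [apply: closedI|]|].
- apply: (closed_comp (f := fun t : T => (t.1.1, t.2)) (D := [set q | subdifferential phi q.1 q.2])).
    by move=> t _; exact: (pairc _ _ c11 c2 t).
  exact: closed_subdifferential_graph.
- apply: (closed_comp (f := fun t : T => (t.1.2, t.2)) (D := [set q | subdifferential phi q.1 q.2])).
    by move=> t _; exact: (pairc _ _ c12 c2 t).
  exact: closed_subdifferential_graph.
- apply: (closed_comp (f := fun t : T => t.1.1 i 0) (D := [set s | s <= a])); last exact: closed_le.
  move=> t _.
  exact: (cvg_comp _ _ (c11 t) (@coord_continuous R n 1 i 0 _)).
- apply: (closed_comp (f := fun t : T => t.1.2 i 0) (D := [set s | b <= s])); last exact: closed_ge.
  move=> t _.
  exact: (cvg_comp _ _ (c12 t) (@coord_continuous R n 1 i 0 _)).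
Qed.

Lemma closed_measurable_cV A : closed A -> measurable A.
Proof.
move=> cA; rewrite -[A]setCK; apply: measurableC; apply: sub_sigma_algebra.
exact: closed_openC.
Qed.

Lemma open_measurable_cV A : open A -> measurable A.
Proof. exact: sub_sigma_algebra. Qed.

Lemma dotcV_delta (i : 'I_n) x : dotcV (delta_mx i 0) x = x i 0.
Proof.
rewrite /dotcV (bigD1 i)//= mxE !eqxx mul1r big1 ?addr0// => j ji.
by rewrite mxE (negbTE ji) mul0r.
Qed.

(** If [p] and [p + t e_i] both belong to the set, monotonicity between the right contact point of
    the former and the left one of the latter gives [t <= 0]; exchanging the two slopes gives
    [t >= 0]. *)
Lemma double_slope_null phi i a b r : continuous phi -> a < b ->
  lebesgue_cV R n (double_slope phi i a b r) = 0%E.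
Proof.
move=> cphi ab.
apply: (@lebesgue_cV_null_lines _ _ _ (delta_mx i 0)).
  by apply: closed_measurable_cV; exact: double_slope_closed.
have key (p : 'cV[R]_n) (t : R) : double_slope phi i a b r p ->
    double_slope phi i a b r (p + t *: delta_mx i 0) -> t <= 0.
  move=> [[x y] _ /= [_ yp _ by_]] [[x' y'] _ /= [x'p _ x'a _]].
  have := subdifferential_monotone x'p yp.
  rewrite addrAC subrr add0r dotcVZl dotcVBr !dotcV_delta; nra.
move=> p t pD ptD; apply: le_anti; rewrite (key p)//=.
rewrite -oppr_le0; apply: (key (p + t *: delta_mx i 0)) => //.
by rewrite scaleNr addrK.
Qed.

(** Distinct points differ in some coordinate, with two rationals in between, so countably many null
    pieces suffice. Off [N] the images of disjoint sets are disjoint, so that [gradient_image phi]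
    behaves like an inverse image. *)
Lemma kinks_null phi : continuous phi -> exists N : set 'cV[R]_n, [/\ measurable N,
  lebesgue_cV R n N = 0%E & forall x y p, x <> y ->
    subdifferential phi x p -> subdifferential phi y p -> N p].
Proof.
move=> cphi.
pose F (m : nat) : set 'cV[R]_n :=
  if (unpickle m : option ('I_n * rat * rat * nat)) is Some (i, a, b, k)
  then if a < b then double_slope phi i (ratr a) (ratr b) k%:R else set0 else set0.
have mF m : measurable (F m).
  rewrite /F; case: unpickle => [[[[i a] b] k]|] //; case: ifPn => // ab.
  by apply: closed_measurable_cV; exact: double_slope_closed.
have F0 m : lebesgue_cV R n (F m) = 0%E.
  rewrite /F; case: unpickle => [[[[i a] b] k]|]; last exact: (measure0 (lebesgue_cV R n)).
  case: ifPn => ab; last exact: (measure0 (lebesgue_cV R n)).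
  by apply: double_slope_null => //; rewrite ltr_rat.
exists (\bigcup_m F m); split.
- by apply: bigcupT_measurable => m; exact: mF.
- have mFl m : @measurable _ (lebesgue_type R n) (F m) by exact: borel_lebesgue_measurable.
  have [+ _] := @negligibleP _ _ _ (lebesgue_cV R n) _ (bigcupT_measurable _ mFl); apply.
  by apply: negligible_bigcup => m; have [_] := @negligibleP _ _ _ (lebesgue_cV R n) _ (mFl m); apply; exact: F0.
- suff H x y p i : x i 0 < y i 0 -> subdifferential phi x p -> subdifferential phi y p ->
    (\bigcup_m F m) p.
  move=> x y p xy xp yp.
  have [i] : exists i, x i 0 != y i 0.
    apply/existsP; apply: contra_notT xy; rewrite negb_exists => /forallP xy.
    by apply/matrixP => i j; rewrite (ord1 j); apply/eqP; have := xy i; rewrite negbK.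
  rewrite neq_lt => /orP[xyi|yxi]; [exact: (H x y p i)|exact: (H y x p i)].
move=> xy xp yp.
have [b bxy] := rat_in_itvoo xy; rewrite in_itv/= in bxy; have /andP[xb b_y] := bxy.
have [a axb] := rat_in_itvoo xb; rewrite in_itv/= in axb; have /andP[xa ab] := axb.
pose k := (Num.truncn (Num.max (enorm x) (enorm y))).+1.
have : Num.max (enorm x) (enorm y) < k%:R by exact: truncnS_gt.
rewrite gt_max => /andP[xk yk].
exists (pickle (i, a, b, k)); first exact: I.
rewrite /F pickleK; rewrite ltr_rat in ab; rewrite ab.
by exists (x, y); split; rewrite //= ?ltW// /cball /= ltW.
Qed.

Lemma cball_cover : \bigcup_k cball k%:R = [set: 'cV[R]_n].
Proof.
apply/seteqP; split=> // v _; exists (Num.truncn (enorm v)).+1 => //=.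
by rewrite /cball /= ltW// truncnS_gt.
Qed.

Lemma gradient_image_bigcup phi (F : nat -> set 'cV[R]_n) :
  gradient_image phi (\bigcup_k F k) = \bigcup_k gradient_image phi (F k).
Proof.
apply/seteqP; split=> [p [x [k _ Fx] xp]|p [k _ [x Fx xp]]].
  by exists k => //; exists x.
by exists x => //; exists k.
Qed.

(** The sets with a measurable image form a sigma-algebra containing the closed sets, which are
    countable unions of compact ones. Complements are the delicate case: the images of [B] and of
    its complement may overlap, but only inside [N]. *)
Lemma gradient_image_measurable phi B : continuous phi -> measurable B ->
  @measurable _ (lebesgue_type R n) (gradient_image phi B).
Proof.
move=> cphi; move: B.
have mclosed C : closed C -> @measurable _ (lebesgue_type R n) (gradient_image phi C).
  move=> cC; rewrite -[C]setIT -cball_cover setI_bigcupr gradient_image_bigcup.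
  apply: bigcupT_measurable => k; apply: borel_lebesgue_measurable.
  apply: closed_measurable_cV; apply: (gradient_image_closed cphi).
  apply: (@subclosed_compact _ _ (cball k%:R)); [|exact: compact_cball|by move=> ? []].
  by apply: closedI => //; exact: closed_cball.
have [N [mN N0 NP]] := kinks_null cphi.
have mC B : @measurable _ (lebesgue_type R n) (gradient_image phi B) ->
    @measurable _ (lebesgue_type R n) (gradient_image phi (~` B)).
  move=> mB.
  have -> : gradient_image phi (~` B) =
      (gradient_image phi setT `\` gradient_image phi B) `|`
      (gradient_image phi B `&` gradient_image phi (~` B)).
    apply/seteqP; split=> [p pB|p [[[x _ xp] pB]|[]]//].
      have [pB'|pB'] := pselect (gradient_image phi B p); first by right.
      by left; split => //; have [x _ xp] := pB; exists x.
    by exists x => //= Bx; apply: pB; exists x.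
  apply: measurableU; first by apply: measurableD => //; apply: mclosed; exact: closedT.
  (* Completeness is used here: the overlap is only known to lie in a Borel null set. *)
  apply: measure_is_complete_caratheodory; exists N; split => //.
    exact: borel_lebesgue_measurable.
  move=> p [[x Bx xp] [y By yp]]; apply: (NP x y) => // xy.
  by apply: By; rewrite -xy.
apply: smallest_sub => /=.
  split=> [|B mB|F mF].
  - rewrite /= (_ : gradient_image phi set0 = set0) ?measurable0//.
    by apply/seteqP; split=> // p [].
  - by rewrite /= setTD; exact: mC.
  - by rewrite /= gradient_image_bigcup; apply: bigcupT_measurable.
move=> U oU /=; rewrite -[U]setCK; apply: mC; apply: mclosed.
exact: open_closedC.
Qed.

End subdifferentials.

(** * Locally uniform limits *)

Section extraction.
Context {R : realType} {n : nat}.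
Implicit Types (phi : nat -> 'cV[R]_n -> R) (psi : 'cV[R]_n -> R) (x y : 'cV[R]_n).

(** The bound is asked only from some index on, because the estimate on a given ball becomes
    available once the source ball is large enough. *)
Definition locally_equilip phi := forall r : R, exists (L : R) (J : nat),
  forall j, (J <= j)%N -> forall x y, cball r x -> cball r y ->
    `|phi j x - phi j y| <= L * enorm (x - y).

Definition ratcV (i : nat) : 'cV[R]_n :=
  \col_k ratr ((odflt 0 (unpickle i : option 'cV[rat]_n)) k 0).

Lemma ratcV_dense x (e : R) : 0 < e -> exists i, enorm (x - ratcV i) < e.
Proof.
move=> e0; have [d d0 dE] : exists2 d, 0 < d & n.+1%:R * d = e.
  by exists (e / n.+1%:R); rewrite ?divr_gt0// mulrC divfK.
have /choice[q qP] : forall k, exists q : rat, `|x k 0 - ratr q| <= d.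
  move=> k; have [|q] := @rat_in_itvoo R (x k 0) (x k 0 + d).
    by rewrite ltrDl.
  rewrite in_itv/= => /andP[xq qx]; exists q.
  by rewrite ler_distlC; apply/andP; split; lra.
exists (pickle (\col_k q k)).
apply: (le_lt_trans (enorm_le_norm _)).
apply: (@le_lt_trans _ _ (n%:R * d)).
  rewrite ler_wpM2l//; apply/norm_cV_leP; first exact: ltW.
  by move=> k; rewrite !mxE pickleK /= mxE.
by rewrite -dE ltr_pM2r// ltr_nat.
Qed.

Lemma cvg_locally_lip (T : Type) (F : set_system T) {FF : ProperFilter F}
    (f : T -> 'cV[R]_n -> R) psi (L : R) x y :
  (\forall t \near F, `|f t x - f t y| <= L * enorm (x - y)) ->
  f t x @[t --> F] --> psi x -> f t y @[t --> F] --> psi y ->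
  `|psi x - psi y| <= L * enorm (x - y).
Proof.
move=> fL fx fy; exact: cvgr_to_le (cvg_norm (cvgB fx fy)) fL.
Qed.

(** Arzela-Ascoli through an ultrafilter: the values at each point are eventually in a compact
    interval, so they converge along an ultrafilter finer than [\oo]; a sequence is then read off by
    matching this limit at more and more points of [ratcV]. The map [s] need not be monotone,
    [m <= s m] suffices. *)
Lemma extraction phi : (forall j, phi j 0 = 0) -> locally_equilip phi ->
  exists (s : nat -> nat) psi, (forall m, (m <= s m)%N) /\
    (forall x, phi (s m) x @[m --> \oo] --> psi x).
Proof.
move=> phi0 phiL.
have [U [UU ooU]] := @ultraFilterLemma nat \oo _.
have near_oo (J : nat) : U [set j | (J <= j)%N] by apply: ooU; exact: nbhs_infty_ge.
have /choice[psi psiP] : forall x, exists l : R, phi j x @[j --> U] --> l.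
  move=> x; have [L [J LJ]] := phiL (enorm x).
  have : compact `[- (L * enorm x), L * enorm x] by exact: segment_compact.
  rewrite compact_ultra => /(_ (phi j x @[j --> U])).
  have Ub : U [set j | `[- (L * enorm x), L * enorm x]%classic (phi j x)].
    apply: filterS (near_oo J) => j /= Jj; rewrite in_itv/= -ler_norml.
    have := LJ j Jj x 0; rewrite phi0 !subr0 /cball /= enorm0 enorm_ge0.
    by move=> /(_ (lexx _) isT).
  have UF : UltraFilter (phi j x @[j --> U]).
    split; first exact: fmap_proper_filter.
    move=> G GF sG; apply/seteqP; split=> // A GA.
    have [//|UA] := in_ultra_setVsetC ((phi ^~ x) @^-1` A) UU.
    have GnA : G (~` A) by exact: sG.
    exfalso; apply: (@filter_not_empty _ G GF).
    by rewrite -(setICr A); exact: filterI.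
  by move=> /(_ UF Ub)[l [_ lP]]; exists l.
have psiL r L J : (forall j, (J <= j)%N -> forall x y, cball r x -> cball r y ->
    `|phi j x - phi j y| <= L * enorm (x - y)) -> forall x y, cball r x -> cball r y ->
    `|psi x - psi y| <= L * enorm (x - y).
  move=> LJ x y xr yr; apply: (@cvg_locally_lip _ U _ phi) => //.
  by apply: filterS (near_oo J) => j /LJ; exact.
have /choice[s sP] : forall m, exists j, (m <= j)%N /\
    forall i : 'I_m.+1, `|phi j (ratcV i) - psi (ratcV i)| < m.+1%:R^-1.
  move=> m.
  have : U [set j | forall i : 'I_m.+1, `|phi j (ratcV i) - psi (ratcV i)| < m.+1%:R^-1].
    apply: filter_forall => i.
    have /cvgrPdist_lt := psiP (ratcV i).
    by move=> /(_ m.+1%:R^-1); rewrite invr_gt0 ltr0n => /(_ isT); apply: filterS => j; rewrite distrC.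
  by move=> /(filterI (near_oo m))/filter_ex[j [mj ?]]; exists j.
exists s, psi; split=> [m|x]; first by have [] := sP m.
have [L [J LJ]] := phiL (enorm x + 1).
apply/cvgrPdist_le => e e0.
have L0 : 0 < `|L| + 1 by rewrite ltr_wpDl.
(* The error splits in three: the functions [phi (s m)] and [psi] each move by at most [e / 3]
   between [x] and the rational point, where they differ by at most [1/(m+1) <= e / 3]. *)
have d0 : 0 < Num.min 1 (e / 3 / (`|L| + 1)) by rewrite lt_min ltr01 !divr_gt0.
have [i] := ratcV_dense x d0; rewrite lt_min => /andP[ix1 ixe].
have xr : cball (enorm x + 1) x by rewrite /cball /= lerDl.
have ir : cball (enorm x + 1) (ratcV i).
  rewrite /cball /= -(subKr x (ratcV i)) (le_trans (enormD _ _))// lerD2l.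
  by rewrite enormN ltW.
have Lxi : L * enorm (x - ratcV i) <= e / 3.
  rewrite ltr_pdivlMr// in ixe.
  rewrite (le_trans _ (ltW ixe))// mulrC ler_wpM2l ?enorm_ge0//.
  by rewrite (le_trans (ler_norm _))// lerDl.
near=> m.
have Jm : (J <= s m)%N by rewrite (leq_trans _ (proj1 (sP m)))//; near: m; exact: nbhs_infty_ge.
have im : (i < m.+1)%N by rewrite ltnS; near: m; exact: nbhs_infty_ge.
have h1 := LJ _ Jm x (ratcV i) xr ir.
have h2 := psiL _ _ _ LJ x (ratcV i) xr ir.
have /= h3 := (sP m).2 (Ordinal im).
have h4 : m.+1%:R^-1 <= e / 3.
  near: m; have : 0 < e / 3 by rewrite divr_gt0.
  move=> e30; have := near_infty_natSinv_lt (PosNum e30).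
  by apply: filterS => m /= /ltW.
move: (m.+1%:R^-1) (L * _) Lxi h4 h1 h2 h3 => c b Lxi h4; rewrite !ler_norml ltr_norml => /andP[? ?] /andP[? ?] /andP[? ?].
by apply/andP; split; lra.
Unshelve. all: by end_near. Qed.

End extraction.

Section compact_cV.
Context {R : realType} {n : nat}.

Lemma compact_min_cV (A : set 'cV[R]_n) (f : 'cV[R]_n -> R) x : A x -> compact A ->
  continuous f -> exists2 c, A c & forall t, A t -> f c <= f t.
Proof.
move=> Ax cA cf.
have [c cA' cmin] := compact_EVT_min (ex_intro _ x Ax : A !=set0) cA (continuous_subspaceT cf).
by exists c => [|t At]; [exact: set_mem|apply: cmin; exact: mem_set].
Qed.

Lemma compact_max_cV (A : set 'cV[R]_n) (f : 'cV[R]_n -> R) x : A x -> compact A ->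
  continuous f -> exists2 c, A c & forall t, A t -> f t <= f c.
Proof.
move=> Ax cA cf.
have [c cA' cmax] := compact_EVT_max (ex_intro _ x Ax : A !=set0) cA (continuous_subspaceT cf).
by exists c => [|t At]; [exact: set_mem|apply: cmax; exact: mem_set].
Qed.

Lemma lip_continuous (f : 'cV[R]_n -> R) :
  (forall r : R, exists L : R, forall x y, cball r x -> cball r y -> `|f x - f y| <= L * enorm (x - y)) ->
  continuous f.
Proof.
move=> fL x; apply/(@cvgrPdist_le _ _ _ (nbhs x) (nbhs_filter x)) => e e0.
have [L LP] := fL (enorm x + 1).
have L0 : 0 < `|L| + 1 by rewrite ltr_wpDl.
apply/nbhs_enorm; exists (Num.min 1 (e / (`|L| + 1))); first by rewrite lt_min ltr01 divr_gt0.
move=> y; rewrite lt_min => /andP[y1 ye].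
have xr : cball (enorm x + 1) x by rewrite /cball /= lerDl.
have yr : cball (enorm x + 1) y.
  by rewrite /cball /= -(subrKC x y) (le_trans (enormD _ _))// lerD2l ltW.
rewrite (le_trans (LP _ _ xr yr))// enormB.
rewrite ltr_pdivlMr// in ye; rewrite (le_trans _ (ltW ye))// mulrC ler_wpM2l ?enorm_ge0//.
by rewrite (le_trans (ler_norm _))// lerDl.
Qed.

Section locally_equilip_limit.
Variables (phi : nat -> 'cV[R]_n -> R) (psi : 'cV[R]_n -> R).
Hypotheses (phiL : locally_equilip phi) (phipsi : forall x, phi m x @[m --> \oo] --> psi x).

Lemma limit_locally_lip (r : R) : exists L : R, forall x y, cball r x -> cball r y ->
  `|psi x - psi y| <= L * enorm (x - y).
Proof.
have [L [J LJ]] := phiL r; exists L => x y xr yr.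
apply: (@cvg_locally_lip _ _ _ \oo _ phi) => //.
by exists J => // j /= Jj; exact: LJ.
Qed.

Lemma limit_continuous : continuous psi.
Proof. exact: lip_continuous limit_locally_lip. Qed.

(** Convergence in the point and the index at once, the form that near-covering arguments on compact
    sets consume. *)
Lemma cvg_joint x : phi t.2 t.1 @[t --> filter_prod (nbhs x) \oo] --> psi x.
Proof.
apply/cvgrPdist_le => e e0.
have [L [J LJ]] := phiL (enorm x + 1).
have L0 : 0 < `|L| + 1 by rewrite ltr_wpDl.
have e20 : 0 < e / 2 by rewrite divr_gt0.
have h1 : nbhs x [set y | enorm (y - x) < Num.min 1 (e / 2 / (`|L| + 1))].
  by apply/nbhs_enorm; exists (Num.min 1 (e / 2 / (`|L| + 1))) => //; rewrite lt_min ltr01 !divr_gt0.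
have h2 : \forall m \near \oo, (J <= m)%N /\ `|psi x - phi m x| <= e / 2.
  apply: filterI; first exact: nbhs_infty_ge.
  by have /cvgrPdist_le := @phipsi x; apply.
exists ([set y | enorm (y - x) < Num.min 1 (e / 2 / (`|L| + 1))], [set m | (J <= m)%N /\ `|psi x - phi m x| <= e / 2]) => //.
move=> [y m] /= []; rewrite lt_min => /andP[y1 ye] [Jm xm].
have xr : cball (enorm x + 1) x by rewrite /cball /= lerDl.
have yr : cball (enorm x + 1) y.
  by rewrite /cball /= -(subrKC x y) (le_trans (enormD _ _))// lerD2l ltW.
have h : `|phi m x - phi m y| <= e / 2.
  rewrite (le_trans (LJ _ Jm _ _ xr yr))// enormB.
  rewrite ltr_pdivlMr// in ye; rewrite (le_trans _ (ltW ye))// mulrC ler_wpM2l ?enorm_ge0//.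
  by rewrite (le_trans (ler_norm _))// lerDl.
by rewrite -(subrK (phi m x) (psi x)) -addrA (le_trans (ler_normD _ _))// (splitr e) lerD.
Qed.

Lemma cvg_locally_uniform (r e : R) : 0 < e ->
  \forall m \near \oo, forall x, cball r x -> `|phi m x - psi x| < e.
Proof.
move=> e0.
have /compact_near_coveringP := @compact_cball R n r.
move=> /(_ nat \oo (fun m x => `|phi m x - psi x| < e) _); apply => x xr.
have c2 : psi t.1 @[t --> filter_prod (nbhs x) \oo] --> psi x.
  have c1 : t.1 @[t --> filter_prod (nbhs x) (\oo : set_system nat)] --> x by exact: cvg_fst.
  exact: (cvg_comp _ _ c1 (@limit_continuous x)).
have c3 : (phi t.2 t.1 - psi t.1) @[t --> filter_prod (nbhs x) \oo] --> (0 : R).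
  by rewrite -(subrr (psi x)); exact: (cvgB (@cvg_joint x) c2).
by have /cvgrPdist_lt/(_ _ e0) := c3; apply: filterS => t; rewrite sub0r normrN.
Qed.

End locally_equilip_limit.
End compact_cV.

(** * Orbits of irreducible groups *)

Section orbits.
Context {R : realType} {n : nat} (K : set 'M[R]_n).
Hypotheses (K_orth : K `<=` orthogonal_group) (K_group : matrix_subgroup K)
  (K_compact : compact K) (K_irr : acts_irreducibly K)
  (K_nontriv : n = 1%N -> K <> [set 1%:M]).
Implicit Types (p x y z v : 'cV[R]_n).

Let K1 : K 1%:M. Proof. by have [] := K_group. Qed.
Let KM k l : K k -> K l -> K (k *m l). Proof. by have [_ + _] := K_group; exact. Qed.
Let KV k : K k -> K (invmx k). Proof. by have [_ _ +] := K_group; exact. Qed.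

(** A nonzero fixed vector spans an invariant line, which by irreducibility is the whole space; in
    dimension 1 it forces every [k] to be the identity. This is where the trivial group on the line
    has to be excluded. *)
Lemma fixed_vector_eq0 v : (forall k, K k -> k *m v = v) -> v = 0.
Proof.
move=> vK; have [//|v0] := eqVneq v 0.
have [k w Kk /vlineP[a ->]||] := K_irr (V := <[v]>%VS).
- by rewrite -scalemxAr vK// memvZ// memv_line.
- by move=> V0; apply/eqP; rewrite -memv0 -V0 memv_line.
move=> VT; exfalso.
have n1 : n = 1%N.
  have := dim_vline v; rewrite VT v0 dimvf /dim /= => <-.
  by rewrite muln1.
apply: (K_nontriv n1); apply/seteqP; split=> [k Kk|_ ->]//=.
have ord_eq (i j : 'I_n) : i = j.
  have lt1 (a : 'I_n) : (a < 1)%N by rewrite -[X in (_ < X)%N]n1.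
  by apply: val_inj => /=; have := lt1 i; have := lt1 j; rewrite !ltnS !leqn0 => /eqP-> /eqP->.
apply/matrixP => i j; rewrite (ord_eq j i) mxE eqxx.
have : (k *m v) i 0 = v i 0 by rewrite vK.
rewrite mxE (bigD1 i)//= big1 ?addr0 => [kv|l]; last by rewrite (ord_eq l i) eqxx.
have vi0 : v i 0 != 0.
  apply: contra v0 => /eqP vi0; apply/eqP/matrixP => a b.
  by rewrite (ord1 b) (ord_eq a i) vi0 mxE.
by apply: (mulIf vi0); rewrite kv mul1r.
Qed.

(** A finite part of the orbit whose span has maximal dimension already spans the whole orbit, so
    its span is invariant; it contains [p] and hence is not zero. *)
Lemma orbit_spans p : p != 0 -> exists s : seq 'cV[R]_n,
  (forall u, u \in s -> exists2 k, K k & u = k *m p) /\ (span s) = fullv.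
Proof.
move=> p0.
pose orb (s : seq 'cV[R]_n) := forall u, u \in s -> exists2 k, K k & u = k *m p.
pose P (m : nat) := `[< exists2 s, orb s & \dim (span s) = m >].
have exP : exists m, P m.
  by exists 0%N; apply/asboolP; exists [::] => //; rewrite span_nil dimv0.
have ubP m : P m -> (m <= \dim (fullv : {vspace 'cV[R]_n}))%N.
  by move=> /asboolP[s _ <-]; apply: dimvS; exact: subvf.
have [m /asboolP[s sorb sm] mmax] := ex_maxnP exP ubP.
exists s; split => //.
have inV k : K k -> k *m p \in (span s).
  move=> Kk; have : P (\dim (span (k *m p :: s))).
    apply/asboolP; exists (k *m p :: s) => // u; rewrite inE => /orP[/eqP->|/sorb//].
    by exists k.
  move=> /mmax; rewrite -sm => dle.
  have /eqP -> : (span s) == (span (k *m p :: s)).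
    by rewrite eqEdim dle andbT span_cons addvSr.
  by rewrite memv_span// mem_head.
have [k v Kk vs|V0|//] := K_irr (V := (span s)).
  have -> : v = \sum_(i < size s) coord (in_tuple s) i v *: s`_i by exact: coord_span.
  rewrite mulmx_sumr rpred_sum// => i _; rewrite -scalemxAr rpredZ//.
  have [l Kl ->] := sorb s`_i (mem_nth _ (ltn_ord i)).
  by rewrite mulmxA inV//; exact: KM.
by have := inV _ K1; rewrite V0 memv0 mul1mx (negbTE p0).
Qed.

Lemma dotcV_adj k x y : K k -> dotcV (k *m x) y = dotcV x (invmx k *m y).
Proof.
move=> Kk; have ko := K_orth Kk.
by rewrite -{1}(mulmxK_invmx ko y) dotcV_mulmx.
Qed.

(* If no k p pointed into the half-space of z, the invariant convex set D would avoid 0, and its point closest to 0 would be fixed by K. *)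
Lemma orbit_not_obtuse p z : p != 0 -> z != 0 -> exists2 k, K k & 0 < dotcV (k *m p) z.
Proof.
move=> p0 z0; apply: contrapT => nex.
have obtuse k : K k -> dotcV (k *m p) z <= 0.
  by move=> Kk; rewrite leNgt; apply/negP => kz; apply: nex; exists k.
have [s [sorb sfull]] := orbit_spans p0.
(* A linear functional, strictly negative on every nonzero vector obtuse to the whole orbit of [p]:
   its terms are then nonpositive, and if all vanish the vector is orthogonal to a spanning
   family. *)
pose l y := \sum_(u <- s) dotcV u y.
have lneg y : (forall k, K k -> dotcV (k *m p) y <= 0) -> y != 0 -> l y < 0.
  move=> yC y0; rewrite ltNge; apply: contra y0 => ly.
  have sy u : u \in s -> dotcV u y = 0.
    move=> us; apply/eqP; rewrite -oppr_eq0; apply/eqP.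
    have ge0 w : w \in s -> 0 <= - dotcV w y.
      by move=> /sorb[k Kk ->]; rewrite oppr_ge0 yC.
    apply: le_anti; rewrite ge0// andbT.
    apply: (le_trans (y := - l y)); last by rewrite oppr_le0.
    have -> : - l y = \sum_(w <- s) - dotcV w y by rewrite /l sumrN.
    rewrite (big_rem u us) /= lerDl big_seq sumr_ge0// => w /mem_rem; exact: ge0.
  have ys : y = \sum_(i < size s) coord (in_tuple s) i y *: s`_i.
    by apply: (@coord_span _ _ _ (in_tuple s)); rewrite /= sfull memvf.
  apply/eqP/dotcV_eq0.
  rewrite {1}ys.
  have -> : dotcV (\sum_(i < size s) coord (in_tuple s) i y *: s`_i) y =
      \sum_(i < size s) coord (in_tuple s) i y * dotcV s`_i y.
    elim/big_rec2 : _ => [|i a b _ <-]; first exact: dotcV0l.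
    by rewrite dotcVDl dotcVZl.
  by rewrite big1// => i _; rewrite sy ?mulr0// mem_nth.
have lD x y : l (x + y) = l x + l y.
  by rewrite /l -big_split; apply: eq_bigr => u _; rewrite dotcVDr.
have lZ a y : l (a *: y) = a * l y.
  by rewrite /l mulr_sumr; apply: eq_bigr => u _; rewrite dotcVZr.
have lcont : continuous l.
  apply: continuous_big => [|u _]; first exact: add_continuous.
  by apply: continuous_dotcV => t; [exact: cst_continuous|exact: (@cvg_id _ (nbhs t))].
have mulcont : continuous (fun k : 'M[R]_n => k *m z).
  have cij i j : continuous (fun k : 'M[R]_n => (k *m z) i j).
    rewrite (_ : (fun k : 'M[R]_n => _) = fun k => \sum_a k i a * z a j); last first.
      by apply/funext => k; rewrite mxE.
    apply: continuous_big => [|a _ k]; first exact: add_continuous.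
    have c := @coord_continuous R n n i a k; exact: (cvgM c (cvg_cst _)).
  move=> k A /nbhs_ballP[e /= e0 eA].
  have H i j : \forall k' \near k, ball ((k *m z) i j) e ((k' *m z) i j).
    exact: (cij i j k _ (nbhsx_ballx ((k *m z) i j) e e0)).
  have : \forall k' \near k, forall ij : 'I_n * 'I_1, ball ((k *m z) ij.1 ij.2) e ((k' *m z) ij.1 ij.2).
    exact: (filter_forall (f := fun (ij : 'I_n * 'I_1) k' =>
      ball ((k *m z) ij.1 ij.2) e ((k' *m z) ij.1 ij.2)) (nbhs_filter k) (fun ij => H ij.1 ij.2)).
  by apply: filterS => k' Hk; apply: eA; split=> // i j; exact: (Hk (i, j)).
have kzC k : K k -> l (k *m z) < 0.
  move=> Kk; apply: lneg => [k' Kk'|].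
    have := obtuse (invmx k *m k') (KM (KV Kk) Kk').
    by rewrite -mulmxA dotcV_adj ?invmxK//; exact: KV.
  apply: contra z0 => /eqP kz; apply/eqP.
  by rewrite -(mulmx_invmxK (K_orth Kk) z) kz mulmx0.
have lkcont : continuous (fun k : 'M[R]_n => l (k *m z)).
  move=> k; apply: (@continuous_comp _ _ _ (fun k : 'M[R]_n => k *m z) l).
    exact: mulcont.
  exact: lcont.
(* Compactness of [K] turns strict negativity into a uniform bound [d < 0] on the orbit of [z]; this
   [d] keeps 0 out of [D]. *)
have [k1 /set_mem Kk1 k1max] :=
  compact_EVT_max (ex_intro _ 1%:M K1 : K !=set0) K_compact (continuous_subspaceT lkcont).
have kmax k : K k -> l (k *m z) <= l (k1 *m z) by move=> Kk; apply: k1max; exact: mem_set.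
have d0 := kzC _ Kk1; set d := l _ in d0 kmax.
pose D := [set y | forall k, K k -> l (k *m y) <= d].
have DK k y : K k -> D y -> D (k *m y).
  by move=> Kk Dy k' Kk'; rewrite mulmxA; apply: Dy; exact: KM.
have Dconv x y : D x -> D y -> D (2^-1 *: (x + y)).
  move=> Dx Dy k Kk; rewrite -scalemxAr mulmxDr lZ lD.
  by have := Dx k Kk; have := Dy k Kk; lra.
have Dz : D z by [].
have Dclosed : closed D.
  have -> : D = \bigcap_(k in K) [set y | l (k *m y) <= d] by [].
  apply: closed_bigI => k Kk.
  have lk : continuous (fun y => l (k *m y)).
    rewrite (_ : (fun y => _) = fun y => \sum_(u <- s) dotcV (invmx k *m u) y); last first.
      apply/funext => y; apply: eq_bigr => u _.
      by rewrite dotcV_adj ?invmxK//; exact: KV.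
    apply: continuous_big => [|u _]; first exact: add_continuous.
    by apply: continuous_dotcV => t; [exact: cst_continuous|exact: (@cvg_id _ (nbhs t))].
  apply: (closed_comp (f := fun y => l (k *m y)) (D := [set t | t <= d])); last exact: closed_le.
  by move=> y _; exact: lk.
pose D' := D `&` cball (enorm z).
have cD' : compact D'.
  apply: (@subclosed_compact _ _ (cball (enorm z))); [|exact: compact_cball|by move=> ? []].
  by apply: closedI => //; exact: closed_cball.
have [|y [Dy yz] ymin] := @compact_min_cV _ _ D' enorm z _ cD' (@enorm_continuous R n).
  by split => //; rewrite /cball /=.
have ymin' x : D x -> enorm y <= enorm x.
  move=> Dx; have [xz|zx] := leP (enorm x) (enorm z); first exact: ymin.
  by rewrite (le_trans yz)// ltW.
(* Strict convexity of the Euclidean norm: [y] and [k y] have equal length and their midpoint, which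
   is in [D], is not shorter, so they coincide. *)
have y_fixed k : K k -> k *m y = y.
  move=> Kk; apply/eqP; rewrite -subr_eq0; apply/eqP/dotcV_eq0/le_anti.
  rewrite dotcV_ge0 andbT.
  have := ymin' _ (Dconv _ _ Dy (DK _ _ Kk Dy)).
  rewrite -ler_sqr ?nnegrE ?enorm_ge0// !enorm_sqr.
  have := dotcV_mulmx y y (K_orth Kk).
  rewrite !dotcVZl !dotcVZr !dotcVDl !dotcVNl !dotcVDr !dotcVNr.
  rewrite (dotcVC y (k *m y)); lra.
have y0 := fixed_vector_eq0 y_fixed.
have := Dy _ K1; rewrite mul1mx y0 -(scale0r 0) lZ mul0r.
by rewrite leNgt d0.
Qed.

(** For a pair of unit vectors, a [k] with positive product still gives half of it on a whole
    neighbourhood; compactness makes the bound uniform and homogeneity extends it to all vectors. *)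
Lemma orbit_support : exists2 c : R, 0 < c &
  forall p z, exists2 k, K k & c * enorm p * enorm z <= dotcV (k *m p) z.
Proof.
pose S := [set v : 'cV[R]_n | enorm v = 1].
have cS : compact S.
  apply: (@subclosed_compact _ _ (cball 1)); [|exact: compact_cball|by move=> v vS; rewrite /cball /= vS].
  apply: (closed_comp (f := enorm) (D := [set t | t = 1])); last exact: closed_eq.
  by move=> v _; exact: enorm_continuous.
have /compact_near_coveringP := compact_setX cS cS.
move=> /(_ nat \oo (fun m pz => exists2 k, K k & m.+1%:R^-1 <= dotcV (k *m pz.1) pz.2) _).
case=> [[p z] [/= pS zS]|m _ mP].
  have nz v : enorm v = 1 -> v != 0.
    by apply: contra_eqN => /eqP ->; rewrite enorm0 eq_sym oner_eq0.
  have [k Kk kpz] := orbit_not_obtuse (nz _ pS) (nz _ zS).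
  set a := dotcV _ _ in kpz.
  have h1 : \forall pz \near (p, z), a / 2 <= dotcV (k *m pz.1) pz.2.
    have c : dotcV pz.1 (invmx k *m pz.2) @[pz --> (p, z)] --> a.
      rewrite /a dotcV_adj//.
      have -> : (fun pz : 'cV[R]_n * 'cV[R]_n => dotcV pz.1 (invmx k *m pz.2)) =
         (fun pz => \sum_i \sum_j pz.1 i 0 * (invmx k i j * pz.2 j 0)).
        apply/funext => pz; apply: eq_bigr => i _; rewrite mxE mulr_sumr.
        by apply: eq_bigr => j _.
      have -> : dotcV p (invmx k *m z) = \sum_i \sum_j p i 0 * (invmx k i j * z j 0).
        apply: eq_bigr => i _; rewrite mxE mulr_sumr.
        by apply: eq_bigr => j _.
      have cf : pz.1 @[pz --> (p, z)] --> p by exact: cvg_fst.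
      have cs : pz.2 @[pz --> (p, z)] --> z by exact: cvg_snd.
      apply: cvg_big => [|i _]; first exact: add_continuous.
      apply: cvg_big => [|j _]; first exact: add_continuous.
      have c1 := cvg_comp _ _ cf (@coord_continuous R n 1 i 0 p).
      have c2 := cvg_comp _ _ cs (@coord_continuous R n 1 j 0 z).
      exact: (cvgM c1 (cvgM (cvg_cst _) c2)).
    have : \forall pz \near (p, z), a / 2 < dotcV pz.1 (invmx k *m pz.2).
      by apply: (cvgr_gt _ c); rewrite gtr_pMr// invf_lt1// ltr1n.
    by apply: filterS => -[p' z'] /= /ltW; rewrite dotcV_adj.
  have h2 : \forall m \near \oo, m.+1%:R^-1 < a / 2.
    have a20 : 0 < a / 2 by rewrite divr_gt0.
    by have := near_infty_natSinv_lt (PosNum a20).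
  exists ([set pz | a / 2 <= dotcV (k *m pz.1) pz.2], [set m | m.+1%:R^-1 < a / 2]) => //.
  by move=> [[p' z'] m] /= [h h']; exists k => //; rewrite (le_trans (ltW h')).
exists m.+1%:R^-1 => // p z.
have [->|p0] := eqVneq p 0; first by exists 1%:M => //; rewrite enorm0 mulr0 mul0r mulmx0 dotcV0l.
have [->|z0] := eqVneq z 0; first by exists 1%:M => //; rewrite enorm0 mulr0 dotcV0r.
have p1 := enorm_gt0 p0; have z1 := enorm_gt0 z0.
have nS v : 0 < enorm v -> S ((enorm v)^-1 *: v).
  by move=> v1; rewrite /S /= enormZ ger0_norm ?invr_ge0 ?enorm_ge0// mulVf// gt_eqF.
have [k Kk kpz] := mP m (leqnn m) ((enorm p)^-1 *: p, (enorm z)^-1 *: z) (conj (nS _ p1) (nS _ z1)).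
exists k => //; move: kpz; rewrite /= -scalemxAr dotcVZl dotcVZr.
by rewrite mulrA -invfM [X in _ <= X]mulrC ler_pdivlMr ?mulr_gt0// mulrA.
Qed.

End orbits.

(** * Invariant transport between two balls *)

Section lipschitz_conjugates.
Context {R : realType} {n : nat}.
Implicit Types (phi psi h : 'cV[R]_n -> R) (x y z p : 'cV[R]_n) (b r : R).

Definition elip b phi := forall x y, `|phi x - phi y| <= b * enorm (x - y).

Lemma elip_le b phi x y : elip b phi -> phi x <= phi y + b * enorm (x - y).
Proof. by move=> /(_ x y); rewrite ler_distl => /andP[_]; rewrite addrC. Qed.

Lemma elipP b phi : (forall x y, phi x <= phi y + b * enorm (x - y)) -> elip b phi.
Proof.
move=> h x y; rewrite ler_distl; have := h x y; have := h y x.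
by rewrite (enormB y x) => ? ?; apply/andP; split; lra.
Qed.

Lemma elip_continuous b phi : elip b phi -> continuous phi.
Proof. by move=> phiL; apply: lip_continuous => r; exists b => x y _ _; exact: phiL. Qed.

Lemma continuous_measurable_cV phi : continuous phi -> measurable_fun [set: 'cV[R]_n] phi.
Proof.
move=> cphi; apply: (measurability _ (RGenOpens.measurableE R)) => _ [_ [a [b ->] <-]].
rewrite setTI; apply: sub_sigma_algebra.
by apply: open_comp; [move=> x _; exact: cphi|exact: interval_open].
Qed.

Lemma elip_subdifferential b phi x p : 0 <= b -> elip b phi -> subdifferential phi x p ->
  enorm p <= b.
Proof.
move=> b0 phiL /(_ (x + p)); rewrite addrAC subrr add0r -enorm_sqr expr2 => h.
have [->|/enorm_gt0 p0] := eqVneq p 0; first by rewrite enorm0.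
have := elip_le (x + p) x phiL; rewrite addrAC subrr add0r => h'.
by rewrite -(ler_pM2r p0); lra.
Qed.

Lemma elip_max b phi psi : elip b phi -> elip b psi -> elip b (phi \max psi).
Proof.
move=> phiL psiL; apply: elipP => x y /=.
rewrite ge_max; apply/andP; split.
  by rewrite (le_trans (elip_le x y phiL))// lerD2r le_max lexx.
by rewrite (le_trans (elip_le x y psiL))// lerD2r le_max lexx orbT.
Qed.

Lemma elip_min b phi psi : elip b phi -> elip b psi -> elip b (phi \min psi).
Proof.
move=> phiL psiL; apply: elipP => x y /=.
rewrite -lerBlDr le_min; apply/andP; split; rewrite lerBlDr.
  by rewrite (le_trans _ (elip_le x y phiL))// ge_min lexx.
by rewrite (le_trans _ (elip_le x y psiL))// ge_min lexx orbT.
Qed.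

Definition bounded_on (D : set 'cV[R]_n) phi := exists M : R, forall x, D x -> `|phi x| <= M.

Lemma elip_bounded b r phi : elip b phi -> bounded_on (cball r) phi.
Proof.
move=> phiL; exists (`|phi 0| + `|b| * r) => x xr.
rewrite -(subrKC (phi 0) (phi x)) (le_trans (ler_normD _ _))// lerD2l.
rewrite (le_trans (phiL _ _))// subr0 (le_trans (ler_wpM2r (enorm_ge0 _) (ler_norm b)))//.
by rewrite ler_wpM2l.
Qed.

(** The Legendre transform with the supremum restricted to a ball, hence finite and [r]-Lipschitz on
    the whole space as soon as [phi] is bounded on that ball and [0 <= r]. *)
Definition ball_conj r phi y : R := sup [set dotcV x y - phi x | x in cball r].

Section ball_conj.
Variable r : R.
Hypothesis r0 : 0 <= r.

Lemma cball0 : cball r (0 : 'cV[R]_n). Proof. by rewrite /cball /= enorm0. Qed.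

Lemma ball_conj_ge phi x y : bounded_on (cball r) phi -> cball r x ->
  dotcV x y - phi x <= ball_conj r phi y.
Proof.
move=> [M phiM] xr; apply: ub_le_sup; last by exists x.
exists (r * enorm y + M) => _ [z zr <-].
apply: lerD; first by rewrite (le_trans (cauchy_schwarz _ _))// ler_wpM2r// enorm_ge0.
by rewrite (le_trans _ (phiM _ zr))// -normrN ler_norm.
Qed.

Lemma ball_conj_le phi y (M : R) : (forall x, cball r x -> dotcV x y - phi x <= M) ->
  ball_conj r phi y <= M.
Proof.
move=> phiM; apply: ge_sup; first by exists (dotcV 0 y - phi 0); exists 0 => //; exact: cball0.
by move=> _ [x xr <-]; exact: phiM.
Qed.

Lemma ball_conj_elip phi : bounded_on (cball r) phi -> elip r (ball_conj r phi).
Proof.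
move=> bphi; apply: elipP => y z; apply: ball_conj_le => x xr.
have -> : dotcV x y = dotcV x z + dotcV x (y - z) by rewrite dotcVBr; ring.
have := ball_conj_ge z bphi xr; have := cauchy_schwarz x (y - z).
have : enorm x * enorm (y - z) <= r * enorm (y - z) by rewrite ler_wpM2r// enorm_ge0.
lra.
Qed.

Lemma ball_conj_decr phi psi y : bounded_on (cball r) phi -> 
  (forall x, cball r x -> phi x <= psi x) -> ball_conj r psi y <= ball_conj r phi y.
Proof.
move=> bphi le; apply: ball_conj_le => x xr.
by rewrite (le_trans _ (ball_conj_ge y bphi xr))// lerD2l lerN2 le.
Qed.

Lemma ball_conj_addc phi (c : R) y : bounded_on (cball r) phi ->
  ball_conj r (fun x => phi x + c) y = ball_conj r phi y - c.
Proof.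
move=> bphi; have bphic : bounded_on (cball r) (fun x => phi x + c).
  have [M phiM] := bphi; exists (M + `|c|) => x xr.
  by rewrite (le_trans (ler_normD _ _))// lerD2r phiM.
apply: le_anti; apply/andP; split.
  by apply: ball_conj_le => x xr; have := ball_conj_ge y bphi xr; lra.
rewrite lerBlDr; apply: ball_conj_le => x xr.
by have := ball_conj_ge y bphic xr; lra.
Qed.

Lemma ball_conj_orthogonal phi k y : orthogonal_group k -> bounded_on (cball r) phi ->
  ball_conj r (phi \o mulmx k) y = ball_conj r phi (k *m y).
Proof.
move=> ko bphi.
have bphik : bounded_on (cball r) (phi \o mulmx k).
  have [M phiM] := bphi; exists M => x xr; apply: phiM.
  by rewrite /cball /= enorm_orthogonal.
apply: le_anti; apply/andP; split; apply: ball_conj_le => x xr.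
  rewrite -(dotcV_mulmx x y ko); apply: (ball_conj_ge (x := k *m x)) => //.
  by rewrite /cball /= enorm_orthogonal.
have := ball_conj_ge (x := invmx k *m x) y bphik.
rewrite /= (mulmxK_invmx ko) /cball /= enorm_orthogonal; last exact: orthogonal_group_invmx.
move=> /(_ xr); rewrite (_ : dotcV (invmx k *m x) y = dotcV x (k *m y))//.
by rewrite -(dotcV_mulmx _ y ko) (mulmxK_invmx ko).
Qed.

(** Together with [ball_conj_max] this is submodularity: the transforms of the minimum and of the
    maximum add up to at most the sum of the two transforms. *)
Lemma ball_conj_min phi psi y : bounded_on (cball r) phi -> bounded_on (cball r) psi ->
  ball_conj r (phi \min psi) y <= Num.max (ball_conj r phi y) (ball_conj r psi y).
Proof.
move=> bphi bpsi; apply: ball_conj_le => x xr /=; rewrite le_max.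
have := ball_conj_ge y bphi xr; have := ball_conj_ge y bpsi xr.
by case: (leP (phi x) (psi x)) => _ ? ?; apply/orP; [left|right].
Qed.

Lemma ball_conj_max phi psi y : bounded_on (cball r) phi -> bounded_on (cball r) psi ->
  ball_conj r (phi \max psi) y <= Num.min (ball_conj r phi y) (ball_conj r psi y).
Proof.
move=> bphi bpsi; rewrite le_min; apply/andP; split; apply: ball_conj_decr => // x _ /=.
  by rewrite le_max lexx.
by rewrite le_max lexx orbT.
Qed.

End ball_conj.

Lemma ball_conj_biconj_le a b phi x : 0 <= b -> bounded_on (cball a) phi ->
  cball a x -> ball_conj b (ball_conj a phi) x <= phi x.
Proof.
move=> b0 bphi xa; apply: ball_conj_le => // y yb.
by have := ball_conj_ge y bphi xa; rewrite dotcVC; lra.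
Qed.

End lipschitz_conjugates.

Section dotcV_continuity.
Context {R : realType} {n : nat}.
Implicit Types x : 'cV[R]_n.

Lemma dotcVl_continuous x : continuous (dotcV x).
Proof.
by apply: continuous_dotcV => t; [exact: cst_continuous|exact: (@cvg_id _ (nbhs t))].
Qed.

Lemma dotcVr_continuous x : continuous (dotcV^~ x).
Proof.
by apply: continuous_dotcV => t; [exact: (@cvg_id _ (nbhs t))|exact: cst_continuous].
Qed.

End dotcV_continuity.

Section mean.
Context {R : realType} {n : nat}.
Variables (mu : {measure set 'cV[R]_n -> \bar R}) (r : R).
Hypothesis mu_fin : (mu (cball r) < +oo)%E.
Implicit Types (phi psi : 'cV[R]_n -> R).

Let mD : measurable (cball r : set 'cV[R]_n).
Proof. by apply: closed_measurable_cV; exact: closed_cball. Qed.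

(** Wide enough for the discontinuous competitors [phi + t 1_U], on which the comparison of masses
    rests. *)
Definition admissible phi := measurable_fun [set: 'cV[R]_n] phi /\ bounded_on (cball r) phi.

Definition mean phi : R := (\int[mu]_(x in cball r) phi x)%R.

Lemma admissible_integrable phi : admissible phi -> mu.-integrable (cball r) (EFin \o phi).
Proof.
move=> [mphi [M phiM]]; apply: measurable_bounded_integrable => //.
  exact: measurable_funTS.
exists M; split; rewrite ?num_real// => N MN x xr.
by rewrite /= (le_trans (phiM _ xr))// ltW.
Qed.

Lemma le_mean phi psi : admissible phi -> admissible psi ->
  (forall x, cball r x -> phi x <= psi x) -> mean phi <= mean psi.
Proof. by move=> ? ? ?; apply: le_Rintegral => //; exact: admissible_integrable. Qed.

Lemma meanD phi psi : admissible phi -> admissible psi ->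
  mean (fun x => phi x + psi x) = mean phi + mean psi.
Proof. by move=> ? ?; apply: RintegralD => //; exact: admissible_integrable. Qed.

Lemma mean_cst c : mean (fun=> c) = c * fine (mu (cball r)).
Proof. exact: Rintegral_cst. Qed.

Lemma admissible_cst c : admissible (fun=> c).
Proof. by split=> //; exists `|c|. Qed.

Lemma admissibleD phi psi : admissible phi -> admissible psi ->
  admissible (fun x => phi x + psi x).
Proof.
move=> [mphi [M phiM]] [mpsi [N psiN]]; split; first exact: measurable_funD.
by exists (M + N) => x xr; rewrite (le_trans (ler_normD _ _))// lerD ?phiM ?psiN.
Qed.

Lemma mean_addc phi c : admissible phi ->
  mean (fun x => phi x + c) = mean phi + c * fine (mu (cball r)).
Proof. by move=> aphi; rewrite meanD ?mean_cst//; exact: admissible_cst. Qed.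

Lemma admissible_indic (c : R) (U : set 'cV[R]_n) : measurable U ->
  admissible (fun x => c * \1_U x).
Proof.
move=> mU; split.
  by apply: measurable_funM => //; exact: measurable_indic.
exists `|c| => x _; rewrite normrM indicE; case: (x \in U); first by rewrite normr1 mulr1.
by rewrite normr0 mulr0.
Qed.

Lemma mean_indic (c : R) (U : set 'cV[R]_n) : measurable U ->
  mean (fun x => c * \1_U x) = c * fine (mu (U `&` cball r)).
Proof.
move=> mU; have a1 := admissible_indic 1 mU.
rewrite /mean RintegralZl//; last first.
  by have := admissible_integrable a1; apply: eq_integrable => // x _; rewrite /= mul1r.
by rewrite /Rintegral integral_indic.
Qed.

Lemma mean_orthogonal phi (k : 'M[R]_n) : orthogonal_group k -> admissible phi ->
  (forall B, measurable B -> mu (mulmx k @^-1` B) = mu B) ->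
  mean (phi \o mulmx k) = mean phi.
Proof.
move=> ko aphi muk; have [mphi [M phiM]] := aphi.
have mk := measurable_fun_linear k.
have kD : mulmx k @^-1` (cball r) = cball r.
  by apply/seteqP; split => x; rewrite /cball /= enorm_orthogonal.
have aphik : admissible (phi \o mulmx k).
  split; first exact: measurableT_comp.
  by exists M => x xr; apply: phiM; rewrite /cball /= enorm_orthogonal.
rewrite /mean /Rintegral; congr fine.
have ik : mu.-integrable (mulmx k @^-1` (cball r)) ((EFin \o phi) \o mulmx k).
  by rewrite kD; exact: admissible_integrable aphik.
have mE : measurable_fun setT (EFin \o phi) by exact/measurable_EFinP.
have := integral_pushforward mk mE ik mD.
rewrite kD => /= <-.
by apply: eq_measure_integral => B mB _; exact: muk.
Qed.

End mean.

(** * The dual variational problem and its greatest minimizer *)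

Section transport.
Context {R : realType} {n : nat} (K : set 'M[R]_n).
Hypotheses (K_orth : K `<=` orthogonal_group) (K_group : matrix_subgroup K).
Variables (alpha beta : {measure set 'cV[R]_n -> \bar R}) (a b : R).
Hypotheses (a0 : 0 <= a) (b0 : 0 <= b).
Hypotheses (alpha_fin : (alpha (cball a) < +oo)%E) (beta_fin : (beta (cball b) < +oo)%E).
Hypothesis (mass_eq : alpha (cball a) = beta (cball b)).
Hypothesis (alphaK : forall k B, K k -> measurable B -> alpha (mulmx k @^-1` B) = alpha B).
Hypothesis (betaK : forall k B, K k -> measurable B -> beta (mulmx k @^-1` B) = beta B).
Implicit Types (phi psi : 'cV[R]_n -> R) (x y z p : 'cV[R]_n).

Let M : R := fine (alpha (cball a)).
Let M0 : 0 <= M. Proof. by rewrite fine_ge0. Qed.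

(** The Kantorovich dual functional for couplings of maximal correlation. *)
Let cost phi : R := mean alpha a phi + mean beta b (ball_conj a phi).

Let adm_elip r c phi : elip c phi -> admissible r phi.
Proof.
move=> phiL; split; first by apply: continuous_measurable_cV; exact: elip_continuous phiL.
exact: elip_bounded phiL.
Qed.

Let adm_conj phi : bounded_on (cball a) phi -> admissible b (ball_conj a phi).
Proof. by move=> bphi; apply: (@adm_elip b a); exact: ball_conj_elip. Qed.

(** Equal masses make the two shifts cancel; this allows the normalization [phi 0 = 0] that
    compactness requires. *)
Let cost_addc phi c : admissible a phi -> cost (fun x => phi x + c) = cost phi.
Proof.
move=> aphi; have [_ bphi] := aphi; rewrite /cost mean_addc//.
have -> : ball_conj a (fun x => phi x + c) = (fun y => ball_conj a phi y + (- c)).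
  by apply/funext => y; rewrite ball_conj_addc.
rewrite mean_addc//; last exact: adm_conj.
rewrite mass_eq; ring.
Qed.

Let cost_le_add phi psi e : admissible a phi -> admissible a psi ->
  (forall x, cball a x -> `|psi x - phi x| <= e) -> cost phi <= cost psi + 2 * M * e.
Proof.
move=> aphi apsi eP; have [_ bphi] := aphi; have [_ bpsi] := apsi.
have h1 : mean alpha a phi <= mean alpha a psi + e * M.
  rewrite -mean_addc//; apply: le_mean => //; first exact: admissibleD (admissible_cst _ _).
  by move=> x /eP; rewrite ler_distl => /andP[? ?]; lra.
have h2 : mean beta b (ball_conj a phi) <= mean beta b (ball_conj a psi) + e * M.
  rewrite /M mass_eq -mean_addc//; last exact: adm_conj.
  apply: le_mean => //; [exact: adm_conj|exact: admissibleD (adm_conj _) (admissible_cst _ _)|].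
  move=> y _; apply: ball_conj_le => // x xa.
  have := ball_conj_ge y bpsi xa; have := eP _ xa; rewrite ler_distl => /andP[? ?]; lra.
rewrite /cost; lra.
Qed.

(** The double transform decreases both terms: it lies below [phi] on the source ball, and the
    triple transform lies below the simple one on the target ball. Any admissible competitor is thus
    replaced by a [b]-Lipschitz one. *)
Let cost_biconj phi : admissible a phi -> cost (ball_conj b (ball_conj a phi)) <= cost phi.
Proof.
move=> aphi; have [_ bphi] := aphi.
have bc : bounded_on (cball b) (ball_conj a phi) by have [] := adm_conj bphi.
have bcL : elip b (ball_conj b (ball_conj a phi)) by exact: ball_conj_elip.
rewrite /cost; apply: lerD; apply: le_mean => //.
- exact: adm_elip bcL.
- by move=> x xa; exact: ball_conj_biconj_le.
- by apply: adm_conj; exact: elip_bounded bcL.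
- exact: adm_conj.
- by move=> y yb; exact: ball_conj_biconj_le.
Qed.

(** The value [phi 0] enters the bounds for the two integrals with opposite signs and cancels by
    equality of the masses. *)
Let cost_ge phi : elip b phi -> - (M * (a * b)) <= cost phi.
Proof.
move=> phiL; have aphi := adm_elip a phiL; have [_ bphi] := aphi.
have h1 : (phi 0 - a * b) * M <= mean alpha a phi.
  rewrite -mean_cst; apply: le_mean => //; first exact: admissible_cst.
  move=> x xa; have := elip_le 0 x phiL; rewrite sub0r enormN.
  have : b * enorm x <= b * a by rewrite ler_wpM2l.
  rewrite (mulrC a b); lra.
have h2 : (- phi 0) * M <= mean beta b (ball_conj a phi).
  rewrite /M mass_eq -mean_cst; apply: le_mean => //; [exact: admissible_cst|exact: adm_conj|].
  by move=> y _; have := ball_conj_ge y bphi (cball0 a0); rewrite dotcV0l; lra.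
rewrite /cost; lra.
Qed.

Let opt : R := inf [set cost phi | phi in elip b].

Let opt_le phi : elip b phi -> opt <= cost phi.
Proof.
move=> phiL; apply: ge_inf; last by exists phi.
by exists (- (M * (a * b))) => _ [psi psiL <-]; exact: cost_ge.
Qed.

Let opt_le_adm phi : admissible a phi -> opt <= cost phi.
Proof.
move=> aphi; rewrite (le_trans _ (cost_biconj aphi))//; apply: opt_le.
apply: ball_conj_elip => //; have [_ bphi] := aphi.
by have [] := adm_conj bphi.
Qed.

Let elip_equilip (phi : nat -> 'cV[R]_n -> R) : (forall j, elip b (phi j)) -> locally_equilip phi.
Proof. by move=> phiL r; exists b, 0%N => j _ x y _ _; exact: phiL. Qed.

Let limit_elip (phi : nat -> 'cV[R]_n -> R) psi : (forall j, elip b (phi j)) ->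
  (forall x, phi j x @[j --> \oo] --> psi x) -> elip b psi.
Proof.
move=> phiL phipsi x y; apply: (@cvg_locally_lip _ _ _ \oo _ phi) => //.
by apply: nearW => j; exact: phiL.
Qed.

Let opt_limit (phi : nat -> 'cV[R]_n -> R) psi :
  (forall j, elip b (phi j)) -> (forall j, cost (phi j) <= opt + j.+1%:R^-1) ->
  (forall x, phi j x @[j --> \oo] --> psi x) -> cost psi <= opt.
Proof.
move=> phiL phiopt phipsi; apply/ler_addgt0Pr => e' e'0.
have d0 : 0 < e' / 2 / (2 * M + 1) by rewrite !divr_gt0// ltr_wpDl// mulr_ge0.
have [N _ NP] := near_infty_natSinv_lt (PosNum (divr_gt0 e'0 (ltr0n R 2))).
have [N' _ N'P] := cvg_locally_uniform (elip_equilip phiL) phipsi a d0.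
pose m := maxn N N'.
have hm : m.+1%:R^-1 < e' / 2 by apply: NP => /=; exact: leq_maxl.
have := cost_le_add (phi := psi) (psi := phi m) (adm_elip a (limit_elip phiL phipsi)) (adm_elip a (phiL m)) (e := e' / 2 / (2 * M + 1)).
have := N'P m (leq_maxr _ _) => /= um /(_ (fun x xa => ltW (um x xa))) h.
rewrite (le_trans h)//.
have h2 : 2 * M * (e' / 2 / (2 * M + 1)) <= e' / 2.
  rewrite mulrCA ler_piMr//; first by rewrite ltW// divr_gt0.
  by rewrite ler_pdivrMr ?mul1r ?lerDl// ltr_wpDl// mulr_ge0.
have := phiopt m; move: (m.+1%:R^-1) hm => t ht; lra.
Qed.

Let optimal phi := [/\ elip b phi, phi 0 = 0 & cost phi <= opt].

Let optimal_limit (phi : nat -> 'cV[R]_n -> R) : (forall j, elip b (phi j)) ->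
  (forall j, phi j 0 = 0) -> (forall j, cost (phi j) <= opt + j.+1%:R^-1) ->
  exists (s : nat -> nat) psi, [/\ forall m, (m <= s m)%N,
    (forall x, phi (s m) x @[m --> \oo] --> psi x) & optimal psi].
Proof.
move=> phiL phi0 phiopt.
have [s [psi [sm spsi]]] := extraction phi0 (elip_equilip phiL).
exists s, psi; split => //; split.
- exact: limit_elip (fun j => phiL (s j)) spsi.
- have := spsi 0; rewrite (_ : (fun m => phi (s m) 0) = cst 0); last first.
    by apply/funext => m; exact: phi0.
  by move=> /(cvg_lim (@Rhausdorff R)) <-; rewrite lim_cst.
- apply: (opt_limit (fun j => phiL (s j)) _ spsi) => j.
  rewrite (le_trans (phiopt (s j)))// lerD2l lef_pV2 ?posrE// ler_nat ltnS; exact: sm.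
Qed.

Let optimal_exists : exists phi, optimal phi.
Proof.
have /choice[phi phiP] : forall j : nat, exists phi, [/\ elip b phi, phi 0 = 0 & cost phi <= opt + j.+1%:R^-1].
  move=> j.
  have hinf : has_inf [set cost phi | phi in elip b].
    split; last by exists (- (M * (a * b))) => _ [psi psiL <-]; exact: cost_ge.
    exists (cost (fun=> 0)); exists (fun=> 0) => // x y.
    by rewrite subrr normr0 mulr_ge0// enorm_ge0.
  have j0 : 0 < j.+1%:R^-1 :> R by [].
  have [_ [phi phiL <-] phij] := inf_adherent j0 hinf.
  exists (fun x => phi x + (- phi 0)); split.
  - by move=> x y; rewrite opprD addrACA subrr addr0; exact: phiL.
  - by rewrite subrr.
  - by rewrite cost_addc ?ltW//; exact: adm_elip phiL.
have [|||_ [psi [_ _ opsi]]] := optimal_limit (phi := phi).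
- by move=> j; have [] := phiP j.
- by move=> j; have [] := phiP j.
- by move=> j; have [] := phiP j.
by exists psi.
Qed.

(** By submodularity the costs of the maximum and of the minimum add up to at most [2 opt], and the
    minimum costs at least [opt]. *)
Let optimal_max phi psi : optimal phi -> optimal psi -> optimal (phi \max psi).
Proof.
move=> [phiL phi0 ophi] [psiL psi0 opsi].
have maxL := elip_max phiL psiL; have minL := elip_min phiL psiL.
split => //=; first by rewrite phi0 psi0 maxxx.
have := opt_le minL => omin.
suff : cost (phi \max psi) + cost (phi \min psi) <= cost phi + cost psi by lra.
have aL (h : 'cV[R]_n -> R) : elip b h -> admissible a h by move=> hL; exact: (adm_elip a hL).
have bL (h : 'cV[R]_n -> R) : elip b h -> bounded_on (cball a) h by move=> /aL[].
have cL (h : 'cV[R]_n -> R) : elip b h -> admissible b (ball_conj a h) by move=> /bL; exact: adm_conj.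
have h1 : mean alpha a (phi \max psi) + mean alpha a (phi \min psi) = mean alpha a phi + mean alpha a psi.
  rewrite -!meanD//; do ?exact: aL.
  by congr mean; apply/funext => x /=; rewrite addr_max_min.
have h2 : mean beta b (ball_conj a (phi \max psi)) + mean beta b (ball_conj a (phi \min psi)) <=
    mean beta b (ball_conj a phi) + mean beta b (ball_conj a psi).
  rewrite -!meanD//; do ?exact: cL.
  apply: le_mean => //; do ?[exact: admissibleD (cL _ _) (cL _ _)].
  move=> y _; have := ball_conj_max a0 y (bL _ phiL) (bL _ psiL).
  have := ball_conj_min a0 y (bL _ phiL) (bL _ psiL).
  by have := addr_max_min (ball_conj a phi y) (ball_conj a psi y); lra.
rewrite /cost; lra.
Qed.

(** Finite maxima stay optimal, so one optimal function nearly attains the pointwise supremum at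
    finitely many rational points at once; a limit of such functions dominates every optimal one at
    rational points, hence everywhere. *)
Let greatest_optimal : exists2 phi, optimal phi & forall psi, optimal psi -> forall x, psi x <= phi x.
Proof.
have [phi0 ophi0] := optimal_exists.
pose S x := [set phi x | phi in optimal].
have ubS x : has_ubound (S x).
  exists (b * enorm x) => _ [phi [phiL p0 _] <-].
  by have := elip_le x 0 phiL; rewrite p0 add0r subr0.
have leS phi x : optimal phi -> phi x <= sup (S x).
  by move=> ophi; apply: ub_le_sup => //; exists phi.
have near_sup (k N : nat) : exists2 phi, optimal phi &
    forall i, (i < N)%N -> sup (S (ratcV i)) <= phi (ratcV i) + k.+1%:R^-1.
  elim: N => [|N [phi ophi phiN]]; first by exists phi0.
  have hs : has_sup (S (ratcV N)) by split => //; exists (phi0 (ratcV N)); exists phi0.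
  have k0 : 0 < k.+1%:R^-1 :> R by [].
  have [_ [psi opsi <-] psiN] := sup_adherent k0 hs.
  exists (phi \max psi); first exact: optimal_max.
  move=> i; rewrite ltnS leq_eqVlt => /orP[/eqP->|iN] /=.
    rewrite -lerBlDr le_max; apply/orP; right; exact: ltW.
  by rewrite -lerBlDr le_max lerBlDr phiN.
have /choice[phi phiP] : forall k : nat, exists phi, optimal phi /\
    forall i, (i < k)%N -> sup (S (ratcV i)) <= phi (ratcV i) + k.+1%:R^-1.
  by move=> k; have [phi ? ?] := near_sup k k; exists phi.
have [j|j|j|s [psi [sm spsi opsi]]] := optimal_limit (phi := phi).
- by have [[]] := phiP j.
- by have [[]] := phiP j.
- by have [[_ _ h] _] := phiP j; rewrite (le_trans h)// lerDl.
exists psi => // chi ochi x.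
have [psiL _ _] := opsi; have [chiL _ _] := ochi.
have rat_le i : chi (ratcV i) <= psi (ratcV i).
  rewrite (le_trans (leS _ _ ochi))//; apply/ler_addgt0Pr => e e0.
  have e20 : 0 < e / 2 by rewrite divr_gt0.
  have [N _ NP] := near_infty_natSinv_lt (PosNum e20).
  have /cvgrPdist_le/(_ _ e20)[N' _ N'P] := spsi (ratcV i).
  pose m := (maxn (maxn N N') i.+1).
  have Nm : (N <= m)%N by rewrite !leq_max leqnn.
  have N'm : (N' <= m)%N by rewrite !leq_max leqnn orbT.
  have im : (i < s m)%N by rewrite (leq_trans _ (sm m))// !leq_max ltnSn orbT.
  have h1 := (phiP (s m)).2 _ im.
  have h2 : (s m).+1%:R^-1 < e / 2 by apply: NP => /=; rewrite (leq_trans Nm).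
  have := N'P _ N'm; rewrite /= ler_distl => /andP[h3 h4].
  by move: ((s m).+1%:R^-1) h1 h2 => c h1 h2; lra.
apply/ler_addgt0Pr => e e0.
(* Both functions are [b]-Lipschitz, so passing from the rational point to [x] costs at most [2 b]
   times their distance. *)
have [i xi] := ratcV_dense x (e := e / (2 * b + 1)) (divr_gt0 e0 (ltr_wpDl (mulr_ge0 (ler0n _ 2) b0) ltr01)).
have h1 := elip_le x (ratcV i) chiL; have h2 := elip_le (ratcV i) x psiL.
rewrite enormB in h2; have h3 := rat_le i.
rewrite ltr_pdivlMr in xi; last by rewrite ltr_wpDl// mulr_ge0.
have := enorm_ge0 (x - ratcV i); move: (enorm _) xi h1 h2 => t; nra.
Qed.

Let greatest_invariant phi : optimal phi -> (forall psi, optimal psi -> forall x, psi x <= phi x) ->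
  invariant_fun K phi.
Proof.
move=> [phiL phi0 ophi] phimax.
have ok k : K k -> optimal (phi \o mulmx k).
  move=> Kk; have ko := K_orth Kk; split => /=.
  - by move=> x y /=; rewrite (le_trans (phiL _ _))// -mulmxBr enorm_orthogonal.
  - by rewrite mulmx0.
  - rewrite /cost mean_orthogonal//; [|exact: adm_elip phiL|by move=> B; exact: alphaK].
    have bphi : bounded_on (cball a) phi by exact: elip_bounded phiL.
    have -> : ball_conj a (phi \o mulmx k) = ball_conj a phi \o mulmx k.
      by apply/funext => y; rewrite ball_conj_orthogonal.
    by rewrite mean_orthogonal//; [exact: adm_conj|by move=> B; exact: betaK].
move=> k x Kk; apply: le_anti; rewrite (phimax _ (ok k Kk) x)/=.
have [_ _ KV] := K_group.
have := phimax _ (ok _ (KV _ Kk)) (k *m x).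
by rewrite /= (mulmx_invmxK (K_orth Kk)).
Qed.

(** The mass clause stands in for the statement that the gradient map pushes [alpha] to [beta]; it
    makes sense without such a map and without densities. *)
Lemma transport : exists phi, [/\ elip b phi, invariant_fun K phi,
  forall x, exists2 p, cball b p & subdifferential phi x p &
  forall (U E : set 'cV[R]_n), open U -> measurable E -> E `<=` cball b ->
    (forall p, E p -> ~ gradient_image phi (cball a `\` U) p) -> (beta E <= alpha U)%E].
Proof.
have [Psi oPsi Psimax] := greatest_optimal.
have PsiK := greatest_invariant oPsi Psimax.
have [PsiL _ optPsi] := oPsi.
have bPsi : bounded_on (cball a) Psi by exact: elip_bounded PsiL.
pose psi := ball_conj a Psi.
have psiL : elip a psi by exact: ball_conj_elip.
have bpsi r : bounded_on (cball r) psi by exact: elip_bounded psiL.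
(* The double transform keeps optimality and invariance, gives every point a slope in the target
   ball, and has [psi] as its own transform on that ball. *)
pose phi := ball_conj b psi.
have phiL : elip b phi by exact: ball_conj_elip.
have bphi r : bounded_on (cball r) phi by exact: elip_bounded phiL.
have phi_opt : cost phi <= opt.
  by rewrite (le_trans (cost_biconj _))//; exact: adm_elip PsiL.
have conj_phi y : cball b y -> ball_conj a phi y = psi y.
  move=> yb; apply: le_anti; rewrite ball_conj_biconj_le//=.
  by apply: ball_conj_decr => // x xa; exact: ball_conj_biconj_le.
have contact x y : cball b y -> phi x + psi y = dotcV x y -> subdifferential phi x y.
  move=> yb xy z; have := ball_conj_ge z (bpsi b) yb; rewrite -/phi.
  by rewrite dotcVBr (dotcVC y x) -xy; lra.
exists phi; split => //.
- move=> k x Kk; have ko := K_orth Kk.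
  have psik : psi \o mulmx k = psi.
    apply/funext => y; rewrite /= /psi -ball_conj_orthogonal//.
    by congr ball_conj; apply/funext => z; exact: PsiK.
  by rewrite /phi -ball_conj_orthogonal// psik.
- move=> x.
  have cf : continuous (fun y => dotcV y x - psi y).
    move=> y; have c1 := @dotcVr_continuous R n x y.
    exact: (cvgB c1 (@elip_continuous _ _ _ _ psiL y)).
  have [y yb ymax] := compact_max_cV (cball0 b0) (@compact_cball R n b) cf.
  exists y => //; apply: contact => //.
  have -> : phi x = dotcV y x - psi y.
    apply: le_anti; apply/andP; split; first by apply: ball_conj_le => // z zb; exact: ymax.
    exact: ball_conj_ge.
  by rewrite subrK dotcVC.
- move=> U E oU mE Eb EU.
  have mU := open_measurable_cV oU.
  (* For [x] and [y] in their balls the quantity [phi x + psi y - <x, y>] is nonnegative, and it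
     vanishes only if [y] is a slope at [x]. On [G j] it is at least [1/(j+1)] for all [x] of the
     source ball outside [U]. *)
  pose G (j : nat) := [set y | cball b y /\
    forall x, cball a x -> ~ U x -> j.+1%:R^-1 <= phi x + psi y - dotcV x y].
  have cG j : closed (G j).
    have -> : G j = cball b `&` \bigcap_(x in cball a `\` U)
        [set y | j.+1%:R^-1 <= phi x + psi y - dotcV x y].
      apply/seteqP; split=> [y [yb h]|y [yb h]]; split => //.
        by move=> x [xa Ux]; exact: h.
      by move=> x xa Ux; exact: (h x (conj xa Ux)).
    apply: closedI; first exact: closed_cball.
    apply: closed_bigI => x _.
    apply: (closed_comp (f := fun y => phi x + psi y - dotcV x y) (D := [set t | j.+1%:R^-1 <= t])); last exact: closed_ge.
    move=> y _.
    have c1 := @dotcVl_continuous R n x y.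
    exact: (cvgB (cvgD (cvg_cst _) (@elip_continuous _ _ _ _ psiL y)) c1).
  have mG j : measurable (G j) by exact: closed_measurable_cV.
  have Gle j : (beta (G j) <= alpha U)%E.
    set t : R := j.+1%:R^-1.
    have t0 : 0 < t by rewrite invr_gt0.
    pose phit x := phi x + t * \1_U x.
    have aphi : admissible a phi by exact: adm_elip phiL.
    have aphit : admissible a phit by apply: admissibleD => //; exact: admissible_indic.
    have [_ bphit] := aphit.
    have := le_trans phi_opt (opt_le_adm aphit).
    rewrite /cost (meanD alpha_fin aphi (admissible_indic _ _ mU)) mean_indic//.
    (* Raising [phi] by [t] on [U] lowers the transform by [t] at each [y] of [G j]: points of [U]
       lose [t], the others were already [t] below the supremum. Elsewhere the transform does not
       increase. Optimality then compares the masses, and [t] cancels. *)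
    have h : mean beta b (ball_conj a phit) + t * fine (beta (G j `&` cball b)) <=
        mean beta b (ball_conj a phi).
      rewrite -mean_indic// -meanD//; last 2 first.
        exact: adm_conj.
        exact: admissible_indic.
      apply: le_mean => //.
      - by apply: admissibleD; [exact: adm_conj|exact: admissible_indic].
      - exact: adm_conj.
      move=> y yb; rewrite indicE conj_phi//.
      have [/set_mem[_ yG]|_] := boolP (y \in G j); last first.
        rewrite mulr0 addr0 -conj_phi//; apply: ball_conj_decr => // x _.
        by rewrite /phit lerDl mulr_ge0// ltW.
      rewrite mulr1 -lerBrDr; apply: ball_conj_le => // x xa; rewrite /phit indicE.
      have [xU|xU] := boolP (x \in U).
        by have := ball_conj_ge y (bphi a) xa; rewrite conj_phi// mulr1; lra.
      have := yG x xa; rewrite -/t => /(_ _); rewrite mulr0 addr0 => /(_ _) H.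
      have := H (fun Ux => negP xU (mem_set Ux)); lra.
    move=> h'; have {h h'} : t * fine (beta (G j `&` cball b)) <= t * fine (alpha (U `&` cball a)) by lra.
    rewrite ler_pM2l//.
    have fa : alpha (U `&` cball a) \is a fin_num.
      rewrite ge0_fin_numE// (le_lt_trans _ alpha_fin)// le_measure ?inE//.
      by apply: measurableI => //; apply: closed_measurable_cV; exact: closed_cball.
      by apply: closed_measurable_cV; exact: closed_cball.
    have Gb : G j `&` cball b = G j by apply/setIidPl => y [].
    have fb : beta (G j) \is a fin_num.
      rewrite ge0_fin_numE// (le_lt_trans _ beta_fin)// le_measure ?inE//.
        by apply: closed_measurable_cV; exact: closed_cball.
      by move=> y [].
    rewrite Gb -lee_fin !fineK// => /le_trans; apply.
    apply: le_measure; rewrite ?inE//.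
    by apply: measurableI => //; apply: closed_measurable_cV; exact: closed_cball.
  have Gmono : {homo G : i j / (i <= j)%N >-> (i <= j)%O}.
    move=> i j ij; apply/subsetPset => y [yb h]; split => // x xa Ux.
    by rewrite (le_trans _ (h x xa Ux))// lef_pV2 ?posrE// ler_nat ltnS.
  (* For a fixed [y] the gap has a positive minimum over the compact part of the source ball outside
     [U]; if that part is empty, [y] is already in [G 0]. *)
  have EG : E `<=` \bigcup_j G j.
    move=> y Ey; have yb := Eb _ Ey.
    have [[x [xa Ux]]|nex] := pselect (exists x, (cball a `\` U) x); last first.
      by exists 0%N => //; split => // x xa Ux; exfalso; apply: nex; exists x.
    have cC : compact (cball a `\` U).
      apply: (@subclosed_compact _ _ (cball a)); [|exact: compact_cball|by move=> ? []].
      by apply: closedI; [exact: closed_cball|exact: open_closedC].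
    have cf : continuous (fun x => phi x + psi y - dotcV x y).
      move=> z; have c1 := @dotcVr_continuous R n y z.
      exact: (cvgB (cvgD (@elip_continuous _ _ _ _ phiL z) (cvg_cst _)) c1).
    have [z [za Uz] zmin] := compact_min_cV (conj xa Ux : (cball a `\` U) x) cC cf.
    have d0 : 0 < phi z + psi y - dotcV z y.
      have : 0 <= phi z + psi y - dotcV z y.
        by have := ball_conj_ge y (bphi a) za; rewrite conj_phi//; lra.
      rewrite le_eqVlt => /orP[/eqP zy|//]; exfalso.
      apply: (EU y Ey); exists z => //; apply: contact => //; lra.
    have [N _ NP] := near_infty_natSinv_lt (PosNum d0).
    exists N => //; split => // w wa Uw.
    by rewrite (le_trans (ltW (NP N (leqnn N))))//= zmin.
  have mUG : measurable (\bigcup_j G j) by exact: bigcupT_measurable.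
  apply: (@le_trans _ _ (beta (\bigcup_j G j))).
    by apply: le_measure; rewrite ?inE.
  have Gcvg : beta (G j) @[j --> \oo] --> beta (\bigcup_j G j).
    exact: nondecreasing_cvg_mu mG mUG Gmono.
  rewrite -(cvg_lim (@ereal_hausdorff R) Gcvg).
  apply: lime_le; first by apply/cvg_ex; exists (beta (\bigcup_j G j)).
  by apply: nearW => j; exact: Gle.
Qed.

End transport.

(** * Measures with a density *)

Section density.
Context {R : realType} {n : nat}.
Implicit Types (h : 'cV[R]_n -> R).
Local Notation lT := (lebesgue_type R n).

Definition ldens h (mh : measurable_fun [set: lT] h) (h0 : forall x, 0 <= h x)
  (B : set lT) : \bar R := (\int[lebesgue_cV R n]_(x in B) (h x)%:E)%E.

(** The same set function on Borel sets only: [transport] compares Borel measures, while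
    subdifferential images are Lebesgue measurable sets, measured by [ldens]. *)
Definition bdens h (mh : measurable_fun [set: lT] h) (h0 : forall x, 0 <= h x)
  (B : set 'cV[R]_n) : \bar R := ldens mh h0 B.

Section instances.
Variables (h : 'cV[R]_n -> R) (mh : measurable_fun [set: lT] h) (h0 : forall x, 0 <= h x).

Let mhA A : measurable_fun (A : set lT) (fun x => (h x)%:E).
Proof. by apply: measurable_funTS; exact/measurable_EFinP. Qed.

Let h0E A : forall x : lT, A x -> (0 <= (h x)%:E)%E.
Proof. by move=> x _; rewrite lee_fin. Qed.

Let ldens0 : ldens mh h0 set0 = 0%E.
Proof. exact: integral_set0. Qed.

Let ldens_ge0 B : (0 <= ldens mh h0 B)%E.
Proof. by apply: integral_ge0 => x _; rewrite lee_fin. Qed.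

Let ldens_sigma : semi_sigma_additive (ldens mh h0).
Proof.
move=> F mF tF mUF.
rewrite /ldens (ge0_integral_bigcup (lebesgue_cV R n) mF (@mhA _) (@h0E _) tF).
by apply: is_cvg_ereal_nneg_natsum_cond => i _ _; exact: ldens_ge0.
Qed.

HB.instance Definition _ := isMeasure.Build _ _ _ (ldens mh h0)
  ldens0 ldens_ge0 ldens_sigma.

Let bdens_sigma : semi_sigma_additive (bdens mh h0).
Proof.
move=> F mF tF mUF.
have mF' i : @measurable _ lT (F i) by exact: borel_lebesgue_measurable.
exact: (ldens_sigma mF' tF (borel_lebesgue_measurable mUF)).
Qed.

HB.instance Definition _ := isMeasure.Build _ _ _ (bdens mh h0)
  ldens0 ldens_ge0 bdens_sigma.

End instances.

Section facts.
Variables (h : 'cV[R]_n -> R) (mh : measurable_fun [set: lT] h) (h0 : forall x, 0 <= h x).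

Lemma ldens_null A : @measurable _ lT A -> lebesgue_cV R n A = 0%E -> ldens mh h0 A = 0%E.
Proof.
move=> mA A0.
have mhA : measurable_fun (A : set lT) (fun x => (h x)%:E).
  by apply: measurable_funTS; exact/measurable_EFinP.
exact: (null_set_integral mA mhA A0).
Qed.

Lemma ldens_orthogonal k A : orthogonal_group k -> (forall x, h (k *m x) = h x) ->
  @measurable _ lT A -> ldens mh h0 (mulmx k @^-1` A) = ldens mh h0 A.
Proof. by move=> ko hk mA; exact: integral_orthogonal. Qed.

Lemma locally_bounded_on (r : R) : locally_bounded h -> bounded_on (cball r) h.
Proof.
move=> hb; have /compact_near_coveringP := @compact_cball R n r.
move=> /(_ nat \oo (fun m x => `|h x| <= m%:R) _) [x _|m _ mP].
  have [M [Mb M0]] : exists M : R, nbhs x [set y | `|h y| <= M] /\ 0 < M.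
    have : \forall M \near +oo, nbhs x [set y | `|h y| <= M] /\ 0 < M.
      by apply: filterI; [exact: hb|exact: nbhs_pinfty_gt].
    by move=> /filter_ex.
  exists ([set y | `|h y| <= M], [set m : nat | M <= m%:R]) => /=.
    split => //; exact: nbhs_infty_ger.
  by move=> [y m] /= [hM Mm]; exact: le_trans Mm.
by exists m%:R => x xr; apply: (mP m) => /=.
Qed.

Lemma cball_measurable (r : R) : measurable (cball r : set 'cV[R]_n).
Proof. by apply: closed_measurable_cV; exact: closed_cball. Qed.

Lemma lebesgue_cV_cball_lty (r : R) : (lebesgue_cV R n (cball r) < +oo)%E.
Proof.
apply: (@lebesgue_cV_bounded_lty _ _ _ (r + 1)) => v i vr.
by rewrite (le_lt_trans (norm_coord_enorm v i))// (le_lt_trans vr)// ltrDl.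
Qed.

Lemma ldens_cball_lty (r : R) : locally_bounded h -> (ldens mh h0 (cball r) < +oo)%E.
Proof.
move=> /(locally_bounded_on r)[M hM].
have mD : @measurable _ lT (cball r) by apply: borel_lebesgue_measurable; exact: cball_measurable.
apply: (@le_lt_trans _ _ (\int[lebesgue_cV R n]_(x in cball r) (cst (`|M|)%:E x))%E).
  have mhA : measurable_fun (cball r : set lT) (fun x => (h x)%:E).
    by apply: measurable_funTS; exact/measurable_EFinP.
  have h0E (x : lT) : cball r x -> (0 <= (h x)%:E)%E by move=> _; rewrite lee_fin.
  apply: (ge0_le_integral (lebesgue_cV R n) mD h0E mhA (measurable_cst _)).
  move=> x xr; rewrite /= lee_fin (le_trans (ler_norm _))// (le_trans (hM _ xr))//.
    exact: ler_norm.
by rewrite integral_cst// lte_mul_pinfty// ?lee_fin// lebesgue_cV_cball_lty.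
Qed.

Lemma ldens_cball_large (c : R) : ldens mh h0 setT = +oo%E ->
  exists k : nat, (c%:E < ldens mh h0 (cball k%:R))%E.
Proof.
move=> hoo.
have mF (k : nat) : @measurable _ lT (cball k%:R) by apply: borel_lebesgue_measurable; exact: cball_measurable.
have ndF : {homo (fun k : nat => cball k%:R : set lT) : i j / (i <= j)%N >-> (i <= j)%O}.
  by move=> i j ij; apply/subsetPset => x; rewrite /cball /= => /le_trans; apply; rewrite ler_nat.
have : (ldens mh h0 (cball (k%:R : R))) @[k --> \oo] --> ldens mh h0 (\bigcup_k cball (k%:R : R)).
  exact: (nondecreasing_cvg_mu mF (bigcupT_measurable _ mF) ndF).
rewrite cball_cover hoo => /cvgeyPgt/(_ c)[k _ /(_ k (leqnn k)) /=].
by exists k.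
Qed.

End facts.
End density.

(** * The equation on a ball *)

Section bounded_problem.
Context {R : realType} {n : nat} (K : set 'M[R]_n).
Hypotheses (K_orth : K `<=` orthogonal_group) (K_group : matrix_subgroup K).
Local Notation lT := (lebesgue_type R n).
Variables (f g : 'cV[R]_n -> R).
Hypotheses (mf : measurable_fun [set: lT] f) (f0 : forall x, 0 <= f x) (fK : invariant_fun K f)
  (fb : locally_bounded f).
Hypotheses (mg : measurable_fun [set: lT] g) (g0 : forall x, 0 <= g x) (gK : invariant_fun K g)
  (gb : locally_bounded g).
Hypothesis n_gt0 : (0 < n)%N.
Hypothesis f_int : ldens mf f0 setT = +oo%E.

Lemma subdifferential_addc (phi : 'cV[R]_n -> R) (c : R) x :
  subdifferential (fun z => phi z + c) x = subdifferential phi x.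
Proof.
apply/seteqP; split => p /= h z; have := h z; lra.
Qed.

Lemma preimage_cball (k : 'M[R]_n) (r : R) : orthogonal_group k ->
  mulmx k @^-1` (cball r) = cball r.
Proof.
by move=> ko; apply/seteqP; split => x; rewrite /cball /= enorm_orthogonal.
Qed.

Lemma annulus_gt0 (r : R) : 0 <= r ->
  (0 < borel_lebesgue_cV n (cball (r + 1) `\` cball r : set 'cV[R]_n))%E.
Proof.
move=> r0.
pose A := [set x : 'cV[R]_n | r < enorm x < r + 1].
have oA : open A.
  have -> : A = enorm @^-1` `]r, r + 1[%classic.
    by apply/seteqP; split => x; rewrite /A /= in_itv.
  by apply: open_comp; [move=> x _; exact: enorm_continuous|exact: interval_open].
pose e : 'cV[R]_n := delta_mx (Ordinal n_gt0) 0.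
have e1 : enorm e = 1 by rewrite /enorm dotcV_delta mxE !eqxx sqrtr1.
have Ae : A ((r + 2^-1) *: e).
  by rewrite /A /= enormZ e1 mulr1 ger0_norm; lra.
have := lebesgue_cV_open_gt0 oA Ae.
rewrite lebesgue_cV_borel; last exact: open_measurable_cV.
move=> /lt_le_trans; apply; apply: le_measure; rewrite ?inE.
- exact: open_measurable_cV.
- by apply: measurableD; exact: cball_measurable.
- move=> x /= /andP[rx xr]; split; first exact: ltW.
  by rewrite /cball /= leNgt rx.
Qed.

(** Both inequalities come from the mass clause of [transport]: with [U] itself in the open case,
    and with the complement of [C] in the closed one, where subtraction from the equal total masses
    reverses it. *)
Lemma bounded_problem (r : R) : 0 <= r -> exists phi : 'cV[R]_n -> R,
  [/\ phi 0 = 0, invariant_fun K phi /\ continuous phi,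
      forall x, exists p, subdifferential phi x p,
      forall C, closed C -> C `<=` cball r ->
        (ldens mg g0 C <= ldens mf f0 (gradient_image phi C))%E &
      forall U, open U -> U `<=` cball r ->
        (ldens mf f0 (gradient_image phi U) <= ldens mg g0 U)%E].
Proof.
move=> r0.
set mu := ldens mg g0; set nu := ldens mf f0.
have mD (s : R) : measurable (cball s : set 'cV[R]_n) by exact: cball_measurable.
have mA : measurable (cball (r + 1) `\` cball r : set 'cV[R]_n) by exact: measurableD.
have A0 := annulus_gt0 r0.
set ann := cball (r + 1) `\` cball r in mA A0.
pose lam := @borel_lebesgue_cV R n.
have {}A0 : (0 < lam ann)%E := A0.
have A_fin : lam ann \is a fin_num.
  rewrite ge0_fin_numE// -lebesgue_cV_borel//.
  apply: le_lt_trans (lebesgue_cV_cball_lty (r + 1)).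
  by apply: le_lebesgue_cV => x [].
have fA0 : 0 < fine (lam ann) by apply: fine_gt0; rewrite A0 ltey_eq A_fin.
have mu_fin : mu (cball r) \is a fin_num.
  by rewrite ge0_fin_numE ?measure_ge0//; exact: ldens_cball_lty.
have [k muk] := ldens_cball_large (fine (mu (cball r))) f_int.
rewrite fineK// -/nu in muk.
pose b : R := k%:R.
have nu_fin : nu (cball b) \is a fin_num.
  by rewrite ge0_fin_numE ?measure_ge0//; exact: ldens_cball_lty.
(* The filler density: the surplus of target mass spread evenly over the annulus. *)
have c0 : 0 <= (fine (nu (cball b)) - fine (mu (cball r))) / fine (lam ann).
  rewrite divr_ge0 ?fine_ge0// subr_ge0; apply: fine_le => //; exact: ltW.
pose alpha : {measure set 'cV[R]_n -> \bar R} := measure_add (mrestr (bdens mg g0) (mD r)) (mscale (NngNum c0) (mrestr lam mA)).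
pose beta : {measure set 'cV[R]_n -> \bar R} := mrestr (bdens mf f0) (mD b).
have alphaE B : alpha B = (mu (B `&` cball r) +
    ((fine (nu (cball b)) - fine (mu (cball r))) / fine (lam ann))%:E * lam (B `&` ann))%E.
  exact: (measure_addE (mrestr (bdens mg g0) (mD r)) (mscale (NngNum c0) (mrestr lam mA)) B).
have betaE B : beta B = nu (B `&` cball b) by [].
have rr1 : (cball r : set 'cV[R]_n) `<=` cball (r + 1).
  by move=> x /= xr; rewrite /cball /= (le_trans xr)// lerDl.
have alphaT B : cball (r + 1) `<=` B -> alpha B = nu (cball b).
  move=> rB; rewrite alphaE.
  have -> : B `&` cball r = cball r by apply/setIidPr/(subset_trans rr1).
  have -> : B `&` ann = ann by apply/setIidPr => x [] /rB.
  rewrite -(fineK A_fin) -EFinM divfK; last first.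
    by rewrite gt_eqF.
  by rewrite -[X in (X + _)%E](fineK mu_fin) -EFinD subrKC fineK.
have beta_b : beta (cball b) = nu (cball b) by rewrite betaE setIid.
have alpha_fin : (alpha (cball (r + 1)) < +oo)%E by rewrite alphaT// -ge0_fin_numE.
have beta_fin : (beta (cball b) < +oo)%E by rewrite beta_b -ge0_fin_numE.
have mass_eq : alpha (cball (r + 1)) = beta (cball b) by rewrite alphaT.
have alphaK k' (B : set 'cV[R]_n) : K k' -> measurable B -> alpha (mulmx k' @^-1` B) = alpha B.
  move=> Kk mB; have ko := K_orth Kk; rewrite !alphaE.
  have -> : mulmx k' @^-1` B `&` cball r = mulmx k' @^-1` (B `&` cball r).
    by rewrite preimage_setI preimage_cball.
  have -> : mulmx k' @^-1` B `&` ann = mulmx k' @^-1` (B `&` ann).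
    by rewrite preimage_setI /ann !setDE preimage_setI -preimage_setC !preimage_cball.
  rewrite /mu ldens_orthogonal//.
  - by rewrite borel_lebesgue_orthogonal//; exact: measurableI.
  - by move=> x; exact: gK.
  - by apply: borel_lebesgue_measurable; exact: measurableI.
have betaK k' (B : set 'cV[R]_n) : K k' -> measurable B -> beta (mulmx k' @^-1` B) = beta B.
  move=> Kk mB; have ko := K_orth Kk; rewrite !betaE.
  have -> : mulmx k' @^-1` B `&` cball b = mulmx k' @^-1` (B `&` cball b).
    by rewrite preimage_setI preimage_cball.
  rewrite /nu ldens_orthogonal//.
  - by move=> x; exact: fK.
  - by apply: borel_lebesgue_measurable; exact: measurableI.
have [phi [phiL phiK phi_sub phiE]] := transport K_orth K_group (addr_ge0 r0 ler01) (ler0n R k)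
  alpha_fin beta_fin mass_eq alphaK betaK.
have cphi := elip_continuous phiL.
pose phi' x := phi x + (- phi 0).
have subE x : subdifferential phi' x = subdifferential phi x by exact: subdifferential_addc.
have gradE B : gradient_image phi' B = gradient_image phi B.
  by apply: eq_bigcupr => x _; exact: subE.
have phi_b B : gradient_image phi B `<=` cball b.
  by move=> p [x _]; exact: (elip_subdifferential (ler0n R k) phiL).
have cgrad C : closed C -> C `<=` cball (r + 1) -> closed (gradient_image phi C).
  move=> cC Cr; apply: gradient_image_closed => //.
  by apply: (@subclosed_compact _ _ (cball (r + 1))) => //; exact: compact_cball.
exists phi'; split.
- by rewrite /phi' subrr.
- split; first by move=> k' x Kk; rewrite /phi' phiK.
  by move=> x; have cx := cphi x; exact: (cvgD cx (cvg_cst _)).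
- by move=> x; have [p _ xp] := phi_sub x; exists p; rewrite subE.
- move=> C cC Cr; rewrite gradE.
  have Cr1 : C `<=` cball (r + 1) by exact: subset_trans rr1.
  have mC := closed_measurable_cV cC.
  have mG := closed_measurable_cV (cgrad _ cC Cr1).
  have mE : measurable (cball b `\` gradient_image phi C) by exact: measurableD.
  have := phiE _ _ (closed_openC cC) mE (@subDsetl _ _ _).
  have -> : cball (r + 1) `\` ~` C = C by rewrite setDE setCK setIidr.
  move=> /(_ (fun p => @proj2 _ _)).
  have fT : (alpha setT < +oo)%E by rewrite alphaT// -ge0_fin_numE.
  have bD : beta (cball b `\` gradient_image phi C) =
      (beta (cball b) - beta (cball b `&` gradient_image phi C))%E.
    exact: measureD.
  have aD : alpha (~` C) = (alpha setT - alpha C)%E.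
    rewrite -setTD -[X in (_ - alpha X)%E]setTI.
    by apply: measureD => //; exact: measurableT.
  rewrite bD aD beta_b alphaT//.
  have gb' : cball b `&` gradient_image phi C = gradient_image phi C by apply/setIidPr; exact: phi_b.
  rewrite gb' => h.
  have aC : alpha C = mu C.
    rewrite alphaE (setIidl Cr) (_ : C `&` ann = set0) ?measure0 ?mule0 ?adde0//.
    by apply/seteqP; split=> // x [/Cr xr [_ /(_ xr)]].
  have bG : beta (gradient_image phi C) = nu (gradient_image phi C).
    by rewrite betaE (setIidl (phi_b _)).
  rewrite aC bG in h.
  have fC : mu C \is a fin_num.
    rewrite ge0_fin_numE ?measure_ge0// (le_lt_trans _ (ldens_cball_lty mg g0 r gb))//.
    apply: le_measure; rewrite ?inE//; exact: borel_lebesgue_measurable.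
  have fG : nu (gradient_image phi C) \is a fin_num.
    rewrite ge0_fin_numE ?measure_ge0// (le_lt_trans _ (ldens_cball_lty mf f0 b fb))//.
    by apply: le_measure; rewrite ?inE; [exact: borel_lebesgue_measurable|exact: borel_lebesgue_measurable|exact: phi_b].
  by move: h; rewrite -(fineK fC) -(fineK fG) -(fineK nu_fin) -!EFinB !lee_fin lerD2l lerN2.
- move=> U oU Ur; rewrite gradE.
  have Ur1 : U `<=` cball (r + 1) by exact: subset_trans rr1.
  pose E := cball b `\` gradient_image phi (cball (r + 1) `\` U).
  have mE : measurable E.
    apply: measurableD => //; apply: closed_measurable_cV; apply: cgrad; last by move=> x [].
    by apply: closedI; [exact: closed_cball|exact: open_closedC].
  have := phiE _ _ oU mE (@subDsetl _ _ _) (fun p => @proj2 _ _).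
  have -> : beta E = nu E.
    by rewrite betaE (setIidl (@subDsetl _ _ _)).
  have -> : alpha U = mu U.
    rewrite alphaE (setIidl Ur) (_ : U `&` ann = set0) ?measure0 ?mule0 ?adde0//.
    by apply/seteqP; split=> // x [/Ur xr [_ /(_ xr)]].
  apply: le_trans.
  (* [E] misses the slopes attained both on [U] and on the rest of the source ball; these all lie in
     [N]. *)
  have [N [mN N0 NP]] := kinks_null cphi.
  have mE' := borel_lebesgue_measurable mE.
  have mN' := borel_lebesgue_measurable mN.
  have mG : @measurable _ lT (gradient_image phi U).
    by apply: gradient_image_measurable => //; exact: open_measurable_cV.
  apply: (@le_trans _ _ (nu (E `|` N))).
    apply: le_measure; rewrite ?inE//; first exact: measurableU.
    move=> p pU; have [pC|pC] := pselect (gradient_image phi (cball (r + 1) `\` U) p).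
      right; have [x Ux xp] := pU; have [y [_ Uy] yp] := pC.
      by apply: (NP x y) => // xy; apply: Uy; rewrite -xy.
    by left; split => //; exact: phi_b pU.
  rewrite (le_trans (measureU2 _ _ _))//.
  by rewrite [X in (_ + X)%E](_ : _ = 0%E) ?adde0//; exact: ldens_null.
Qed.

End bounded_problem.

(** * Passage to the whole space *)

Section gradient_measure.
Context {R : realType} {n : nat}.
Local Notation lT := (lebesgue_type R n).
Variables (h : 'cV[R]_n -> R) (mh : measurable_fun [set: lT] h) (h0 : forall x, 0 <= h x).
Variable phi : 'cV[R]_n -> R.
Hypothesis cphi : continuous phi.

(** Removing [N] from each image makes the images of disjoint sets disjoint and changes no mass. *)
Lemma gradient_measure_sigma : semi_sigma_additive
  (fun B : set 'cV[R]_n => ldens mh h0 (gradient_image phi B)).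
Proof.
move=> F mF tF mUF.
have [N [mN N0 NP]] := kinks_null cphi.
have mN' := borel_lebesgue_measurable mN.
have mG B : measurable B -> @measurable _ lT (gradient_image phi B).
  exact: gradient_image_measurable.
have nullD B : measurable B ->
    ldens mh h0 (gradient_image phi B) = ldens mh h0 (gradient_image phi B `\` N).
  move=> /mG mB; apply: le_anti; apply/andP; split; last first.
    by apply: le_measure; rewrite ?inE; [exact: measurableD|exact: mB|exact: subDsetl].
  apply: (@le_trans _ _ (ldens mh h0 ((gradient_image phi B `\` N) `|` N))).
    apply: le_measure; rewrite ?inE; [exact: mB|by apply: measurableU => //; exact: measurableD|].
    by move=> p pB; have [pN|pN] := pselect (N p); [right|left].
  rewrite (le_trans (measureU2 _ _ _))//; first exact: measurableD.
  by rewrite [X in (_ + X)%E](_ : _ = 0%E) ?adde0//; exact: ldens_null.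
rewrite nullD// gradient_image_bigcup setD_bigcupl.
under eq_fun do under eq_bigr do rewrite nullD//.
have mD i : @measurable _ lT (gradient_image phi (F i) `\` N).
  by apply: measurableD => //; exact: mG.
apply: measure_semi_sigma_additive => //; last exact: bigcupT_measurable.
apply/trivIsetP => i j _ _ ij; apply/seteqP; split=> // p [[[x Fx xp] pN] [[y Fy yp] _]].
apply: pN; apply: (NP x y) => // xy.
have Fij := (trivIsetP.1 tF) i j I I ij.
by have : (F i `&` F j) x; [split => //; rewrite xy|rewrite Fij].
Qed.

Lemma gradient_image0 : gradient_image phi set0 = set0.
Proof. by apply/seteqP; split=> // p []. Qed.

(* Both inequalities are equalities on a bounded open set, since it is an increasing union of closed sets. *)
Lemma gradient_measure_eq (mu : {measure set 'cV[R]_n -> \bar R}) :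
  (forall r : R, (mu (cball r) < +oo)%E) ->
  (forall (r : R) C, closed C -> C `<=` cball r -> (mu C <= ldens mh h0 (gradient_image phi C))%E) ->
  (forall (r : R) U, open U -> U `<=` cball r -> (ldens mh h0 (gradient_image phi U) <= mu U)%E) ->
  forall B, measurable B -> mu B = ldens mh h0 (gradient_image phi B).
Proof.
move=> mu_fin mu_closed mu_open.
pose nu : set 'cV[R]_n -> \bar R := fun B => ldens mh h0 (gradient_image phi B).
have nu0 : nu set0 = 0%E by rewrite /nu gradient_image0 measure0.
have nu_ge0 B : (0 <= nu B)%E by exact: measure_ge0.
pose nuM : {measure set 'cV[R]_n -> \bar R} :=
  HB.pack nu (isMeasure.Build _ _ _ nu nu0 nu_ge0 gradient_measure_sigma).
pose G : set (set 'cV[R]_n) := [set U | open U /\ exists r : R, U `<=` cball r].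
pose oball (k : nat) : set 'cV[R]_n := [set x | enorm x < k%:R].
have oball_open k : open (oball k).
  have -> : oball k = enorm @^-1` `]-oo, k%:R[%classic.
    by apply/seteqP; split => x; rewrite /oball /= in_itv.
  by apply: open_comp; [move=> x _; exact: enorm_continuous|exact: interval_open].
have oball_cball k : oball k `<=` cball k%:R by move=> x /ltW.
have oballT : \bigcup_k oball k = setT.
  by apply/seteqP; split=> // x _; exists (Num.truncn (enorm x)).+1 => //=; exact: truncnS_gt.
move=> B mB; rewrite -[RHS]/(nuM B).
apply: (measure_unique G oball) => //.
- apply/seteqP; split; last first.
    apply: smallest_sub; first exact: sigma_algebra_measurable.
    by move=> U [oU _]; exact: open_measurable_cV.
  apply: smallest_sub; first exact: smallest_sigma_algebra.
  move=> U oU; have -> : U = \bigcup_k (U `&` oball k) by rewrite -setI_bigcupr oballT setIT.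
  have mU (A : nat -> set (g_sigma_algebraType G)) :
      (forall k, measurable (A k)) -> measurable (\bigcup_k A k).
    by move=> mA; exact: bigcupT_measurable.
  apply: (mU) => k; apply: sub_sigma_algebra; split; first exact: openI.
  by exists k%:R => x [_ /oball_cball].
- move=> U V [oU [r Ur]] [oV _]; split; first exact: openI.
  by exists r => x [/Ur].
- by move=> k; split => //; exists k%:R.
- move=> U [oU [r Ur]]; apply: le_anti; apply/andP; split; last exact: mu_open Ur.
  (* Points at distance at least [1/(j+1)] from the complement of [U]: closed sets increasing to
     [U]. *)
  pose C (j : nat) := [set x : 'cV[R]_n | forall y, ~ U y -> j.+1%:R^-1 <= enorm (x - y)].
  have CU j : C j `<=` U.
    move=> x Cx; apply: contrapT => Ux; have := Cx x Ux.
    by rewrite subrr enorm0 leNgt invr_gt0 ltr0n.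
  have cC j : closed (C j).
    have -> : C j = \bigcap_(y in ~` U) [set x | j.+1%:R^-1 <= enorm (x - y)] by [].
    apply: closed_bigI => y _.
    apply: (closed_comp (f := fun x : 'cV[R]_n => enorm (x - y)) (D := [set t : R | j.+1%:R^-1 <= t])); last exact: closed_ge.
    move=> x _; apply: (@elip_continuous _ _ 1 (fun x => enorm (x - y))); apply: elipP => {}x z.
    rewrite mul1r (_ : x - y = (z - y) + (x - z)) ?enormD//.
    by rewrite [RHS]addrC addrA subrK.
  have UC : U = \bigcup_j C j.
    apply/seteqP; split=> [x Ux|x [j _ /CU]//].
    have /nbhs_enorm[e e0 eU] : nbhs x U by exact: open_nbhs_nbhs.
    have [N _ NP] := near_infty_natSinv_lt (PosNum e0).
    exists N => // y Uy; rewrite leNgt; apply/negP => xy; apply: Uy; apply: eU.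
    by rewrite enormB (lt_trans xy)//; exact: (NP N (leqnn N)).
  have mC j : measurable (C j) by exact: closed_measurable_cV.
  have ndC : {homo C : i j / (i <= j)%N >-> (i <= j)%O}.
    move=> i j ij; apply/subsetPset => x Cx y Uy.
    by rewrite (le_trans _ (Cx y Uy))// lef_pV2 ?posrE// ler_nat ltnS.
  have Ccvg : mu (C j) @[j --> \oo] --> mu U.
    rewrite [in X in _ --> mu X]UC.
    exact: (nondecreasing_cvg_mu mC (bigcupT_measurable _ mC) ndC).
  rewrite -(cvg_lim (@ereal_hausdorff R) Ccvg).
  apply: lime_le; first by apply/cvg_ex; exists (mu U).
  apply: nearW => j; apply: (@le_trans _ _ (nu (C j))).
    by apply: (mu_closed r) => //; exact: subset_trans Ur.
  apply: (@le_measure _ _ _ nuM); rewrite ?inE; [exact: mC|exact: open_measurable_cV|exact: CU].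
- move=> k; apply: le_lt_trans (mu_fin k%:R).
  by apply: le_measure; rewrite ?inE; [exact: open_measurable_cV|exact: cball_measurable|exact: oball_cball].
Qed.

End gradient_measure.

Section convexity.
Context {R : realType} {n : nat}.
Implicit Types (phi : 'cV[R]_n -> R) (x y : 'cV[R]_n).

(** Average the supporting inequalities at the intermediate point: the slope terms cancel. *)
Lemma subdifferentiable_convex phi x y (t : R) : (forall x, exists p, subdifferential phi x p) ->
  0 <= t -> t <= 1 -> phi (t *: x + (1 - t) *: y) <= t * phi x + (1 - t) * phi y.
Proof.
move=> sub t0 t1; have [p pP] := sub (t *: x + (1 - t) *: y).
have := pP x; have := pP y; set w := t *: x + (1 - t) *: y; set a := phi w.
have : t * dotcV p (x - w) + (1 - t) * dotcV p (y - w) = 0.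
  by rewrite /w !dotcVBr !dotcVDr !dotcVZr; ring.
move: (dotcV p (x - w)) (dotcV p (y - w)) (phi x) (phi y) => u v b c e h1 h2.
have := ler_wpM2l t0 h2; have : 0 <= 1 - t by rewrite subr_ge0.
move=> t1' h3; have := ler_wpM2l t1' h1; lra.
Qed.

Lemma convex_functionP phi :
  (forall x y (t : R), 0 <= t -> t <= 1 -> phi (t *: x + (1 - t) *: y) <= t * phi x + (1 - t) * phi y) ->
  convex_function [set: convex_lmodType 'cV[R]_n] phi.
Proof.
move=> phiC t x y _ _; exact: phiC.
Qed.

End convexity.

(** * Slope bounds uniform in the source radius, and slopes of limits *)

Section global_problem.
Context {R : realType} {n : nat} (K : set 'M[R]_n).
Hypotheses (K_orth : K `<=` orthogonal_group) (K_group : matrix_subgroup K)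
  (K_compact : compact K) (K_irr : acts_irreducibly K)
  (K_nontriv : n = 1%N -> K <> [set 1%:M]).
Local Notation lT := (lebesgue_type R n).
Variables (f g : 'cV[R]_n -> R).
Hypotheses (mf : measurable_fun [set: lT] f) (f0 : forall x, 0 <= f x) (fK : invariant_fun K f)
  (fb : locally_bounded f).
Hypotheses (mg : measurable_fun [set: lT] g) (g0 : forall x, 0 <= g x) (gK : invariant_fun K g)
  (gb : locally_bounded g).
Hypothesis f_int : ldens mf f0 setT = +oo%E.
Implicit Types (phi : 'cV[R]_n -> R) (x y z p q : 'cV[R]_n).

Let mu := ldens mg g0.
Let nu := ldens mf f0.

(** The space [R^0] is itself a ball, where a locally bounded [f] has finite mass. Positive
    dimension is what gives the annulus positive measure. *)
Lemma dimension_gt0 : (0 < n)%N.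
Proof.
rewrite lt0n; apply/eqP => n0.
have : (nu (cball 0) < +oo)%E by exact: ldens_cball_lty.
suff c0 : cball 0 = [set: lT] by rewrite c0 /nu f_int.
apply/(@seteqP 'cV[R]_n); split=> // x _.
rewrite /cball /= (_ : x = 0) ?enorm0//.
by apply/matrixP => i; have := ltn_ord i; rewrite [X in (_ < X)%N]n0.
Qed.

(** Invariance lets the supporting inequality at [x] be tested at any point of the orbit of [z]; a
    well chosen one gains [c |p| |z|]. *)
Lemma invariant_growth (c : R) phi x p : invariant_fun K phi -> subdifferential phi x p ->
  (forall p z, exists2 k, K k & c * enorm p * enorm z <= dotcV (k *m p) z) ->
  forall z, phi x + c * enorm p * enorm z - dotcV p x <= phi z.
Proof.
move=> phiK xp cP z; have [k Kk ckz] := cP p z.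
have [_ _ KV] := K_group.
have := xp (invmx k *m z); rewrite phiK; last exact: KV.
move: ckz; rewrite (dotcV_adj K_orth)// dotcVBr; lra.
Qed.

Lemma gradient_bound (rho : R) : 0 <= rho -> exists (L : R) (s : R), forall phi,
  invariant_fun K phi -> continuous phi -> (forall x, exists p, subdifferential phi x p) ->
  (forall U, open U -> U `<=` cball s -> (nu (gradient_image phi U) <= mu U)%E) ->
  forall x p, cball rho x -> subdifferential phi x p -> enorm p <= L.
Proof.
move=> rho0.
have [c c0 cP] := orbit_support K_orth K_group K_compact K_irr K_nontriv.
(* Beyond radius [s], half of the growth term [c |p| |z|] pays for [<p, x>] and the other half for a
   slope [q] of length at most [c |p| / 2]. The minimum of [phi - <q, .>] over [cball s] is
   therefore global. *)
pose s := 2 * rho / c.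
have s0 : 0 <= s by rewrite divr_ge0// ?mulr_ge0// ltW.
have mu_fin : mu (cball (s + 1)) \is a fin_num.
  by rewrite ge0_fin_numE ?measure_ge0//; exact: ldens_cball_lty.
have [T muT] := ldens_cball_large (fine (mu (cball (s + 1)))) f_int.
rewrite fineK// in muT.
(* If [|p| > 2 T / c], the slopes attained on [cball s] fill the ball of radius [T], whose [f]-mass
   was chosen too large. The radius [s + 1] leaves room for an open ball around [cball s], as the
   upper bound on masses concerns open sets. *)
exists (2 * T%:R / c), (s + 1) => phi phiK cphi phi_sub phi_open x p xrho xp.
have growth := invariant_growth phiK xp cP.
have phi_min : phi 0 <= phi x.
  have [q q0] := phi_sub 0.
  have := invariant_growth phiK q0 cP x; rewrite dotcV0r subr0.
  by have := mulr_ge0 (mulr_ge0 (ltW c0) (enorm_ge0 q)) (enorm_ge0 x); lra.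
have p_x : dotcV p x <= enorm p * rho.
  by rewrite (le_trans (cauchy_schwarz p x))// ler_wpM2l// enorm_ge0.
have covered : cball (c * enorm p / 2) `<=` gradient_image phi (cball s).
  move=> q qp; rewrite /cball /= in qp.
  have cf : continuous (fun z => phi z - dotcV q z).
    by move=> z; exact: (cvgB (cphi z) (@dotcVl_continuous R n q z)).
  have [w ws wmin] := compact_min_cV (cball0 s0) (@compact_cball R n s) cf.
  exists w => // z; rewrite dotcVBr.
  have [zs|sz] := leP (enorm z) s; first by have := wmin z zs; lra.
  have := wmin 0 (cball0 s0); rewrite dotcV0r subr0 => w0.
  have h1 := growth z.
  have h2 : dotcV q z <= c * enorm p / 2 * enorm z.
    by rewrite (le_trans (cauchy_schwarz q z))// ler_wpM2r// enorm_ge0.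
  have h3 : enorm p * rho <= c * enorm p * enorm z / 2.
    have : 2 * rho <= c * enorm z by rewrite [c * _]mulrC -ler_pdivrMr// ltW.
    by move=> h; have := ler_wpM2l (enorm_ge0 p) h; lra.
  lra.
rewrite leNgt; apply/negP => pT.
have Tp : T%:R <= c * enorm p / 2.
  by move: pT; rewrite ltr_pdivrMr// => /ltW; lra.
pose U : set 'cV[R]_n := [set z | enorm z < s + 1].
have oU : open U.
  have -> : U = enorm @^-1` `]-oo, s + 1[%classic.
    by apply/seteqP; split => z; rewrite /U /= in_itv.
  by apply: open_comp; [move=> z _; exact: enorm_continuous|exact: interval_open].
have : (nu (cball T%:R) <= mu (cball (s + 1)))%E.
  apply: (@le_trans _ _ (nu (gradient_image phi U))).
    apply: le_measure; rewrite ?inE.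
    - by apply: borel_lebesgue_measurable; exact: cball_measurable.
    - by apply: gradient_image_measurable => //; exact: open_measurable_cV.
    - move=> q qT; have [w ws wq] : gradient_image phi (cball s) q.
        by apply: covered; exact: le_trans Tp.
      by exists w => //; rewrite /U /= (le_lt_trans ws)// ltrDl.
  apply: (@le_trans _ _ (mu U)); first by apply: phi_open => // z /ltW.
  apply: le_measure; rewrite ?inE.
  - by apply: borel_lebesgue_measurable; exact: open_measurable_cV.
  - by apply: borel_lebesgue_measurable; exact: cball_measurable.
  - by move=> z /ltW.
by rewrite leNgt muT.
Qed.

Section limit.
Variables (chi : nat -> 'cV[R]_n -> R) (phi : 'cV[R]_n -> R).
Hypotheses (chiL : locally_equilip chi) (chi_phi : forall x, chi m x @[m --> \oo] --> phi x).
Hypothesis chi_cont : forall m, continuous (chi m).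
Hypothesis chi_sub : forall m x, exists p, subdifferential (chi m) x p.
Hypothesis chi_bound : forall rho : R, exists (L : R) (J : nat), forall m, (J <= m)%N ->
  forall x p, cball rho x -> subdifferential (chi m) x p -> enorm p <= L.

Let cphi : continuous phi. Proof. exact: limit_continuous chiL chi_phi. Qed.

(** If [p] is no slope of [phi] on [C], every [x] in [C] has a test point strictly violating the
    supporting inequality. The violation persists at nearby points and large indices, and
    compactness of [C] makes the index uniform. *)
Let gradient_limsup C p : compact C ->
  (forall J : nat, exists2 m, (J <= m)%N & gradient_image (chi m) C p) -> gradient_image phi C p.
Proof.
move=> cC io; apply: contrapT => pC.
have /compact_near_coveringP := cC.
move=> /(_ nat \oo (fun m x => ~ subdifferential (chi m) x p) _) [x Cx|J _ JP].
  have [z] : exists z, phi z < phi x + dotcV p (z - x).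
    apply: contrapT => nz; apply: pC; exists x => // z.
    by rewrite leNgt; apply/negP => zx; apply: nz; exists z.
  rewrite -subr_gt0 => zx.
  have c1 : t.1 @[t --> filter_prod (nbhs x) (\oo : set_system nat)] --> x by exact: cvg_fst.
  have c3 : chi t.2 z @[t --> filter_prod (nbhs x) (\oo : set_system nat)] --> phi z.
    move=> A /(@chi_phi z) hA; exists (setT, [set m | A (chi m z)]).
      by split; [exact: filterT|exact: hA].
    by move=> [y m] [_].
  have c4 := cvg_comp _ _ c1 (@dotcVl_continuous R n p x).
  have c5 := @cvg_joint _ _ _ _ chiL chi_phi x.
  rewrite dotcVBr in zx.
  have c6 : (chi t.2 t.1 + (dotcV p z - dotcV p t.1) - chi t.2 z)
      @[t --> filter_prod (nbhs x) (\oo : set_system nat)] -->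
      phi x + (dotcV p z - dotcV p x) - phi z.
    by apply: cvgB => //; apply: cvgD => //; apply: cvgB => //; exact: cvg_cst.
  have c7 : \forall t \near filter_prod (nbhs x) (\oo : set_system nat),
      0 < chi t.2 t.1 + (dotcV p z - dotcV p t.1) - chi t.2 z.
    exact: (cvgr_gt _ c6 _ zx).
  apply: (filterS (F := filter_prod (nbhs x) (\oo : set_system nat)) _ c7).
  move=> -[y m] /= h ymp; move: h; have := ymp z; rewrite dotcVBr.
  by rewrite subr_gt0 leNgt => /negP.
have [m Jm [x Cx xp]] := io J.
exact: (JP m Jm x Cx).
Qed.

(** Strictness on the sphere puts the minimum of [chi m - <p, .>] over the closed ball in its
    interior, and by convexity a local minimum is global. *)
Let chi_local_min m x p (e : R) : 0 < e ->
  (forall z, enorm (z - x) = e -> chi m x + dotcV p (z - x) < chi m z) ->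
  exists2 w, enorm (w - x) < e & subdifferential (chi m) w p.
Proof.
move=> e0 sphere.
pose B := [set z | enorm (z - x) <= e].
have cB : compact B.
  have -> : B = (fun z => z + x) @` cball e.
    apply/seteqP; split=> [z zB|_ [z ze <-]]; last by rewrite /B /= addrK.
    by exists (z - x) => //; rewrite subrK.
  apply: continuous_compact; last exact: compact_cball.
  by apply: continuous_subspaceT => z; exact: (cvgD (@cvg_id _ (nbhs z)) (cvg_cst _)).
have cf : continuous (fun z => chi m z - dotcV p z).
  by move=> z; exact: (cvgB (@chi_cont m z) (@dotcVl_continuous R n p z)).
have Bx : B x by rewrite /B /= subrr enorm0 ltW.
have [w wB wmin] := compact_min_cV Bx cB cf.
have we : enorm (w - x) < e.
  rewrite lt_neqAle wB andbT; apply/eqP => wx.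
  have := sphere w wx; have := wmin x Bx; rewrite dotcVBr; lra.
exists w => //.
have [q qP] := chi_sub m w.
move=> z; rewrite dotcVBr.
(* A point close to w on the segment [w, z] lies in B, which bounds the slope of chi m from below there. *)
have [->|zw] := eqVneq z w; first by lra.
have d0 := enorm_gt0 (_ : z - w != 0); rewrite subr_eq0 in d0; have {}d0 := d0 zw.
pose t := Num.min 1 ((e - enorm (w - x)) / enorm (z - w)).
have t0 : 0 < t by rewrite lt_min ltr01 divr_gt0// subr_gt0.
have t1 : t <= 1 by rewrite ge_min lexx.
pose v := t *: z + (1 - t) *: w.
have vE : v - w = t *: (z - w).
  by rewrite /v scalerBl scale1r scalerBr addrA addrAC addrK.
have vB : B v.
  rewrite /B /= (_ : v - x = (v - w) + (w - x)); last by rewrite addrA subrK.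
  have tz : t * enorm (z - w) <= e - enorm (w - x).
    by rewrite -ler_pdivlMr// /t ge_min lexx orbT.
  have := enormD (v - w) (w - x); rewrite vE enormZ ger0_norm ?(ltW t0)//; lra.
have := wmin v vB.
have := subdifferentiable_convex z w (chi_sub m) (ltW t0) t1; rewrite -/v => h1.
have -> : dotcV p v = dotcV p w + t * dotcV p (z - w).
  by rewrite -dotcVZr -vE -dotcVDr subrKC.
rewrite dotcVBr => h2.
have : 0 <= t * (chi m z - chi m w - (dotcV p z - dotcV p w)) by lra.
by rewrite pmulr_rge0//; lra.
Qed.

(** As [p] is attained at [x] only, [phi] exceeds its supporting plane by a positive gap on a small
    sphere around [x]; uniform convergence keeps the inequality strict, so every late [chi m]
    attains [p] inside the sphere. *)
Let gradient_liminf U x p : open U -> U x -> subdifferential phi x p ->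
  (forall y, subdifferential phi y p -> y = x) ->
  exists J : nat, forall m, (J <= m)%N -> gradient_image (chi m) U p.
Proof.
move=> oU Ux xp uniq.
have /nbhs_enorm[e e0 eU] : nbhs x U by exact: open_nbhs_nbhs.
pose d := e / 2.
have d0 : 0 < d by rewrite divr_gt0.
pose S := [set z | enorm (z - x) = d].
pose r := enorm x + d.
have Sr : S `<=` cball r.
  by move=> z Sz; rewrite /cball /= -(subrKC x z) (le_trans (enormD _ _))// lerD2l Sz.
have cenorm : continuous (fun z => enorm (z - x)).
  apply: (@elip_continuous _ _ 1); apply: elipP => y z.
  by rewrite mul1r (_ : y - x = (z - x) + (y - z)) ?enormD// [RHS]addrC addrA subrK.
have cS : compact S.
  apply: (@subclosed_compact _ _ (cball r)); [|exact: compact_cball|exact: Sr].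
  apply: (closed_comp (f := fun z : 'cV[R]_n => enorm (z - x)) (D := [set t : R | t = d])); last exact: closed_eq.
  by move=> z _; exact: cenorm.
have cf : continuous (fun z => phi z - dotcV p z).
  by move=> z; exact: (cvgB (cphi (x := z)) (@dotcVl_continuous R n p z)).
have [gap gap0 gapP] : exists2 gap, 0 < gap & forall z, S z -> phi x + dotcV p (z - x) + gap <= phi z.
  have [[y Sy]|noS] := pselect (exists y, S y); last first.
    by exists 1 => // z Sz; exfalso; apply: noS; exists z.
  have [w Sw wmin] := compact_min_cV Sy cS cf.
  exists (phi w - dotcV p w - (phi x - dotcV p x)); last first.
    by move=> z /wmin; rewrite dotcVBr; lra.
  have : phi x - dotcV p x <= phi w - dotcV p w by have := xp w; rewrite dotcVBr; lra.
  rewrite le_eqVlt => /orP[/eqP wx|]; last by rewrite subr_gt0.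
  have wp : subdifferential phi w p.
    by move=> z; have := xp z; rewrite !dotcVBr; lra.
  exfalso; move: Sw; rewrite /S /= (uniq w wp) subrr enorm0 => d00.
  by rewrite -d00 ltxx in d0.
(* Errors below [gap / 3] at [x] and on the sphere leave at least a third of the gap. *)
have g30 : 0 < gap / 3 by rewrite divr_gt0.
have [J _ JP] := cvg_locally_uniform chiL chi_phi r g30.
exists J => m Jm.
have close z : cball r z -> `|chi m z - phi z| < gap / 3 by exact: JP.
have xr : cball r x by rewrite /cball /= lerDl ltW.
have [w wd wp] : exists2 w, enorm (w - x) < d & subdifferential (chi m) w p.
  apply: chi_local_min => // z Sz.
  have := gapP z Sz; have := close x xr; have := close z (Sr z Sz).
  by rewrite !ltr_distl => /andP[? ?] /andP[? ?]; lra.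
exists w => //; apply: eU; rewrite (lt_trans wd)// /d ltr_pdivrMr// mulr2n mulrDr mulr1 ltrDl//.
Qed.

(** The limsup of the images of [C] lies in [gradient_image phi C]. The uniform slope bound keeps
    the unions [F m] in one ball of finite mass, as continuity from above requires. *)
Lemma limit_closed C (r : R) : closed C -> C `<=` cball r ->
  (exists J : nat, forall m, (J <= m)%N -> (mu C <= nu (gradient_image (chi m) C))%E) ->
  (mu C <= nu (gradient_image phi C))%E.
Proof.
move=> clC Cr [J JP]; have [L [J' J'P]] := chi_bound r.
have cC : compact C by apply: (@subclosed_compact _ _ (cball r)) => //; exact: compact_cball.
pose F (m : nat) : set lT := \bigcup_(i in [set i | (m + maxn J J' <= i)%N]) gradient_image (chi i) C.
have mG i : @measurable _ lT (gradient_image (chi i) C).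
  apply: borel_lebesgue_measurable; apply: closed_measurable_cV.
  exact: (gradient_image_closed (@chi_cont i) cC).
have mF m : measurable (F m) by apply: bigcup_measurable => i _; exact: mG.
have FL m : F m `<=` cball L.
  move=> p [i /= mi [x Cx xp]]; apply: (J'P i _ x p) => //; last exact: Cr.
  by rewrite (leq_trans _ mi)// (leq_trans (leq_maxr J J'))// leq_addl.
have F0_fin : (nu (F 0%N) < +oo)%E.
  apply: le_lt_trans (ldens_cball_lty mf f0 L fb).
  apply: le_measure; rewrite ?inE; [exact: mF| |exact: FL].
  by apply: borel_lebesgue_measurable; exact: cball_measurable.
have niF : {homo F : i j / (i <= j)%N >-> (j <= i)%O}.
  move=> i j ij; apply/subsetPset => p [k /= jk pk]; exists k => //=.
  by rewrite (leq_trans _ jk)// leq_add2r.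
have mI : measurable (\bigcap_m F m) by exact: bigcapT_measurable.
have Fcvg : nu (F m) @[m --> \oo] --> nu (\bigcap_m F m).
  exact: nonincreasing_cvg_mu F0_fin mF mI niF.
apply: (@le_trans _ _ (nu (\bigcap_m F m))).
  rewrite -(cvg_lim (@ereal_hausdorff R) Fcvg).
  apply: lime_ge; first by apply/cvg_ex; exists (nu (\bigcap_m F m)).
  apply: nearW => m; pose i := (m + maxn J J')%N.
  apply: (@le_trans _ _ (nu (gradient_image (chi i) C))).
    by apply: JP; rewrite (leq_trans (leq_maxl J J'))// leq_addl.
  by apply: le_measure; rewrite ?inE; [exact: mG|exact: mF|move=> p pi; exists i => /=].
apply: le_measure; rewrite ?inE //.
- by apply: gradient_image_measurable => //; exact: closed_measurable_cV.
- move=> p pF; apply: gradient_limsup => // j.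
  have [i /= ji pi] := pF j I; exists i => //.
  by rewrite (leq_trans _ ji)// leq_addr.
Qed.

(** Off [N] the liminf of the images contains [gradient_image phi U]; continuity from below asks for
    no bound, so [U] may be unbounded. *)
Lemma limit_open U : open U ->
  (exists J : nat, forall m, (J <= m)%N -> (nu (gradient_image (chi m) U) <= mu U)%E) ->
  (nu (gradient_image phi U) <= mu U)%E.
Proof.
move=> oU [J JP].
have [N [mN N0 NP]] := kinks_null cphi.
have mN' := borel_lebesgue_measurable mN.
pose F (m : nat) : set lT := \bigcap_(i in [set i | (m + J <= i)%N]) gradient_image (chi i) U.
have mG i : @measurable _ lT (gradient_image (chi i) U).
  by apply: gradient_image_measurable; [exact: chi_cont|exact: open_measurable_cV].
have mF m : measurable (F m).
  apply: bigcap_measurable; first by exists (m + J)%N => /=.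
  by move=> i _; exact: mG.
have mUF : measurable (\bigcup_m F m) by exact: bigcupT_measurable.
have ndF : {homo F : i j / (i <= j)%N >-> (i <= j)%O}.
  move=> i j ij; apply/subsetPset => p ip k /= jk; apply: ip => /=.
  by rewrite (leq_trans _ jk)// leq_add2r.
have Fcvg : nu (F m) @[m --> \oo] --> nu (\bigcup_m F m).
  exact: nondecreasing_cvg_mu mF mUF ndF.
have Fle : (nu (\bigcup_m F m) <= mu U)%E.
  rewrite -(cvg_lim (@ereal_hausdorff R) Fcvg).
  apply: lime_le; first by apply/cvg_ex; exists (nu (\bigcup_m F m)).
  apply: nearW => m; pose i := (m + J)%N.
  apply: (@le_trans _ _ (nu (gradient_image (chi i) U))).
    by apply: le_measure; rewrite ?inE; [exact: mF|exact: mG|move=> p; apply => /=].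
  by apply: JP; rewrite leq_addl.
apply: le_trans Fle.
apply: (@le_trans _ _ (nu ((\bigcup_m F m) `|` N))).
  apply: le_measure; rewrite ?inE.
  - by apply: gradient_image_measurable => //; exact: open_measurable_cV.
  - exact: measurableU.
  - move=> p [x Ux xp]; have [pN|pN] := pselect (N p); [by right|left].
    have [|j jP] := gradient_liminf oU Ux xp.
      by move=> y yp; apply: contrapT => yx; apply: pN; exact: (NP y x).
    by exists j => // i /= ji; apply: jP; rewrite (leq_trans _ ji)// leq_addr.
rewrite (le_trans (measureU2 _ _ _))//.
by rewrite [X in (_ + X)%E](_ : _ = 0%E) ?adde0//; exact: ldens_null.
Qed.

End limit.
End global_problem.

Lemma subgradient_bound_lip {R : realType} {n : nat} (phi : 'cV[R]_n -> R) (r L : R) :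
  (forall x, exists p, subdifferential phi x p) ->
  (forall x p, cball r x -> subdifferential phi x p -> enorm p <= L) ->
  forall x y, cball r x -> cball r y -> `|phi x - phi y| <= L * enorm (x - y).
Proof.
move=> sub bound.
have le x y : cball r x -> phi x - phi y <= L * enorm (x - y).
  move=> xr; have [p xp] := sub x.
  have := xp y; rewrite -opprB dotcVNr => h.
  have := cauchy_schwarz p (x - y); have := ler_wpM2r (enorm_ge0 (x - y)) (bound x p xr xp).
  move: (dotcV _ _) h (L * _) (enorm p * _) => u h v w; lra.
move=> x y xr yr; have := le x y xr; have := le y x yr; rewrite enormB ler_norml.
by move: (L * _) => v h1 h2; apply/andP; split; lra.
Qed.

Unset Implicit Arguments.
Theorem theorem0p1 (R : realType) (n : nat) (K : set 'M[R]_n)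
    (f g : 'cV[R]_n -> R)
    (K_orth : K `<=` orthogonal_group)
    (K_group : matrix_subgroup K)
    (K_compact : compact K)
    (K_irr : acts_irreducibly K)
    (* Excludes the trivial action on R^1, for which the result is false: take
       f the indicator of the positive half-line and g = 1. *)
    (K_nontriv : n = 1%N -> K <> [set 1%:M])
    (f_ge0 : forall y, 0 <= f y)
    (g_ge0 : forall x, 0 <= g x)
    (f_inv : invariant_fun K f)
    (g_inv : invariant_fun K g)
    (f_meas : measurable_fun [set: lebesgue_type R n] f)
    (g_meas : measurable_fun [set: lebesgue_type R n] g)
    (f_lbnd : locally_bounded f)
    (g_lbnd : locally_bounded g)
    (f_int : (\int[lebesgue_cV R n]_y (f y)%:E = +oo)%E) :
  exists phi : 'cV[R]_n -> R,
    [/\ convex_function [set: convex_lmodType 'cV[R]_n] phi,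
        invariant_fun K phi
      & monge_ampere_weak_solution f g phi].
Proof.
have f_oo : ldens f_meas f_ge0 setT = +oo%E := f_int.
have n0 := dimension_gt0 f_lbnd f_oo.
have /choice[psi psiP] := fun j : nat => bounded_problem K_orth K_group f_inv f_lbnd
  g_meas g_ge0 g_inv g_lbnd n0 f_oo (ler0n R j).
have psi_bound (rho : R) : exists (L : R) (J : nat), forall j, (J <= j)%N ->
    forall x p, cball rho x -> subdifferential (psi j) x p -> enorm p <= L.
  have rho0 : 0 <= Num.max 0 rho by rewrite le_max lexx.
  have [L [s Ls]] := gradient_bound K_orth K_group K_compact K_irr K_nontriv
    g_meas g_ge0 g_lbnd f_oo rho0.
  (* From this index on the ball of radius [j] contains [cball s], where [gradient_bound] asks for
     the inequality on open sets. *)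
  exists L, (Num.truncn s).+1 => j sj x p xrho.
  have [_ [psiK psic] psi_sub _ psi_open] := psiP j.
  apply: (Ls _ psiK psic psi_sub); last by rewrite /cball /= le_max xrho orbT.
  move=> U oU Us; apply: psi_open => // z /Us zs.
  rewrite /cball /= (le_trans zs)// (le_trans (ltW (truncnS_gt s)))//.
  by rewrite ler_nat.
have psiL : locally_equilip psi.
  move=> r; have [L [J LJ]] := psi_bound r; exists L, J => j Jj.
  have [_ _ psi_sub _ _] := psiP j.
  exact: subgradient_bound_lip psi_sub (LJ j Jj).
have [s [phi [sm spsi]]] := extraction (fun j => let: And5 psi0 _ _ _ _ := psiP j in psi0) psiL.
pose chi m := psi (s m).
have chiL : locally_equilip chi.
  move=> r; have [L [J LJ]] := psiL r; exists L, J => m Jm.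
  by apply: LJ; rewrite (leq_trans Jm).
have chi_cont m : continuous (chi m) by have [_ [_ h] _ _ _] := psiP (s m).
have chi_sub m x : exists p, subdifferential (chi m) x p by have [_ _ h _ _] := psiP (s m); exact: h.
have chi_bound (rho : R) : exists (L : R) (J : nat), forall m, (J <= m)%N ->
    forall x p, cball rho x -> subdifferential (chi m) x p -> enorm p <= L.
  have [L [J LJ]] := psi_bound rho; exists L, J => m Jm.
  by apply: LJ; rewrite (leq_trans Jm).
have cphi : continuous phi := limit_continuous chiL spsi.
(* On a fixed ball all but finitely many [chi m] satisfy both inequalities, which is all that the
   limit lemmas require. *)
have near_r (r : R) : exists J : nat, forall m : nat, (J <= m)%N -> cball r `<=` (cball (s m)%:R : set 'cV[R]_n).
  exists (Num.truncn r).+1 => m rm x xr; rewrite /cball /= (le_trans xr)//.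
  by rewrite (le_trans (ltW (truncnS_gt r)))// ler_nat (leq_trans rm).
exists phi; split.
- apply: convex_functionP => x y t t0 t1.
  have c : (t * psi (s m) x + (1 - t) * psi (s m) y) @[m --> \oo] --> t * phi x + (1 - t) * phi y.
    by apply: cvgD; apply: cvgM => //; exact: cvg_cst.
  apply: (ler_cvg_to (@spsi (t *: x + (1 - t) *: y)) c); apply: nearW => m /=.
  exact: (subdifferentiable_convex x y (chi_sub m) t0 t1).
- move=> k x Kk; apply: (cvg_unique (@Rhausdorff R) (@spsi (k *m x))).
  rewrite (_ : (fun m => psi (s m) (k *m x)) = (fun m => psi (s m) x)); first exact: spsi.
  by apply/funext => m; have [_ [psiK _] _ _ _] := psiP (s m); exact: psiK.
- move=> B mB.
  change (bdens g_meas g_ge0 B = ldens f_meas f_ge0 (gradient_image phi B)).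
  apply: (gradient_measure_eq (h0 := f_ge0) cphi (mu := bdens g_meas g_ge0)) mB.
  + by move=> r; exact: ldens_cball_lty.
  + move=> r C cC Cr; apply: (limit_closed f_lbnd chiL spsi chi_cont chi_bound cC Cr).
    have [J JP] := near_r r; exists J => m Jm.
    have [_ _ _ psi_closed _] := psiP (s m).
    by apply: psi_closed => //; exact: subset_trans (JP m Jm).
  + move=> r U oU Ur; apply: (limit_open chiL spsi chi_cont chi_sub oU).
    have [J JP] := near_r r; exists J => m Jm.
    have [_ _ _ _ psi_open] := psiP (s m).
    by apply: psi_open => //; exact: subset_trans (JP m Jm).
Qed.
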